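(* Let $K\subset\mathbb{E}^{2}$ be a convex body with non-empty interior. If $K$ is a multiple translative tile (i.e. there are a positive integer $k$ and a discrete multiset $X$ in $\mathbb{E}^{2}$ such that $K+X$ is a $k$-fold translative tiling of $\mathbb{E}^{2}$), then $K$ is a multiple lattice tile (i.e. there are a positive integer $k'$, possibly different from $k$, and a lattice $\Lambda$ in $\mathbb{E}^{2}$ such that $K+\Lambda$ is a $k'$-fold lattice tiling of $\mathbb{E}^{2}$).
   Context: $\mathbb{E}^{2}$ is the Euclidean plane. A convex body is a compact convex set; $\mathrm{int}(K)$ denotes its interior. A discrete multiset $X$ in $\mathbb{E}^2$ is a multiset of points having only finitely many members (counted with multiplicity) in each bounded region; translates $K+\mathbf{x}$, $\mathbf{x}\in X$, are counted with the multiplicity of $\mathbf{x}$ in $X$. A lattice in $\mathbb{E}^2$ is a discrete subgroup of rank $2$ (the set of integer combinations of two linearly independent vectors). For a positive integer $k$, $K+X$ is called a $k$-fold translative tiling of $\mathbb{E}^{2}$ (and $K$ a translative $k$-tile) if every point of $\mathbb{E}^{2}$ belongs to at least $k$ of the translates $K+\mathbf{x}$, $\mathbf{x}\in X$, and every point of $\mathbb{E}^{2}$ belongs to at most $k$ of the translates $\mathrm{int}(K)+\mathbf{x}$, $\mathbf{x}\in X$. If moreover $X$ is a lattice, $K+X$ is called a $k$-fold lattice tiling and $K$ a lattice $k$-tile. $K$ is a multiple translative (respectively lattice) tile if it is a translative (respectively lattice) $k$-tile for some positive integer $k$. *)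

(* Defs.v *)
From mathcomp Require Import all_boot all_order all_algebra.
From mathcomp Require Import all_classical all_reals all_analysis.

Set Implicit Arguments.
Unset Strict Implicit.
Unset Printing Implicit Defensive.

Import Order.TTheory GRing.Theory Num.Theory.
Import numFieldNormedType.Exports.

Local Open Scope classical_set_scope.
Local Open Scope ring_scope.

(* The library norm on 'rV[R]_2 is the sup norm; it has the same bounded sets,
   compact sets and interiors as the Euclidean norm. *)
Notation plane R := 'rV[R]_2.

Definition convex_body (R : realType) (K : set (plane R)) : Prop :=
  compact K /\ convex_set K.

Definition translate (R : realType) (A : set (plane R)) (x : plane R) :
  set (plane R) := [set y + x | y in A].

(* A multiset is given by its multiplicity function. Multiplicities are natural
   numbers, so finitely many members in B with multiplicity amounts to a finite
   support in B. *)
Definition discrete_multiset (R : realType) (X : plane R -> nat) : Prop :=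
  forall B : set (plane R), bounded_set B ->
    finite_set (B `&` [set x | X x != 0%N]).

(* Number of translates A + x, x in X, containing p, counted with multiplicity.
   The library sum is 0 when infinitely many terms are nonzero; this does not
   occur for A bounded and X discrete, see finite_covering_translates. *)
Definition cover_count (R : realType) (A : set (plane R)) (X : plane R -> nat)
    (p : plane R) : nat :=
  \big[addn/0%N]_(x \in [set x | translate A x p]) X x.

Lemma finite_covering_translates (R : realType) (A : set (plane R))
    (X : plane R -> nat) (p : plane R) :
  bounded_set A -> discrete_multiset X ->
  finite_set ([set x | translate A x p] `&` [set x | X x != 0%N]).
Proof.
move=> bA; apply.
have [M [Mreal MA]] := bA.
exists (`|p| + (M + 1)); split; first by rewrite num_real.
move=> r pMr x /= [y Ay yxp].
have -> : x = p - y by rewrite -yxp addrAC subrr add0r.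
apply: (le_trans (ler_normB _ _)); apply: le_trans (ltW pMr).
by rewrite lerD2l; apply: (MA _ _ _ Ay); rewrite ltrDl ltr01.
Qed.

Definition is_kfold_translative_tiling (R : realType) (k : nat)
    (K : set (plane R)) (X : plane R -> nat) : Prop :=
  discrete_multiset X /\
  forall p : plane R,
    (k <= cover_count K X p)%N /\ (cover_count (interior K) X p <= k)%N.

Definition multiple_translative_tile (R : realType) (K : set (plane R)) : Prop :=
  exists k : nat, exists X : plane R -> nat,
    (0 < k)%N /\ is_kfold_translative_tiling k K X.

Definition is_lattice (R : realType) (L : set (plane R)) : Prop :=
  exists u v : plane R, free [:: u; v] /\
    L = [set x | exists a b : int, x = u *~ a + v *~ b].

Definition multiset_of_set (R : realType) (L : set (plane R)) : plane R -> nat :=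
  fun x => nat_of_bool (x \in L).

Definition is_kfold_lattice_tiling (R : realType) (k : nat)
    (K : set (plane R)) (L : set (plane R)) : Prop :=
  is_lattice L /\ is_kfold_translative_tiling k K (multiset_of_set L).

Definition multiple_lattice_tile (R : realType) (K : set (plane R)) : Prop :=
  exists k : nat, exists L : set (plane R),
    (0 < k)%N /\ is_kfold_lattice_tiling k K L.

(* Main.v *)
(* For an edge vector e of K let c be the translation carrying the opposite edge
   onto that edge. Crossing the lines parallel to e at generic points shows that
   a tiling multiset X is balanced: the half-open windows p - [0, 1) e and
   p + c - [0, 1) e contain equally many points of X. (The same local argument
   shows first that K is a polygon and that opposite edges have equal length.)
   Conversely, every nonempty discrete multiset balanced for all edges yields a
   multiple tiling, so a balanced lattice has to be found.
     Balance implies (1 - T_e)(1 - T_c) X = 0, where T_v is translation by v.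
   Applying the operators 1 - T_c in turn, each time the result does not vanish,
   one gets Y <> 0 of locally finite support which for every edge has the period e
   or the period c. If K has at least three edge directions, two of these periods
   g1, g2 are linearly independent, and since the support of Y is locally finite
   the pigeonhole principle makes all the periods rational over g1, g2. If e is
   the period, the windows of X meeting the support of Y are moreover c-invariant,
   and a second pigeonhole argument makes c rational modulo R e. Hence the lattice
   (Z g1 + Z g2) / N is balanced for a suitable N. With only two edge directions K
   is a parallelogram, and its edges generate a lattice. *)
Require Import Defs.
From mathcomp Require Import all_boot all_order all_algebra.
From mathcomp Require Import ring lra zify.
From mathcomp Require Import all_classical all_reals all_analysis.

Set Implicit Arguments.
Unset Strict Implicit.
Unset Printing Implicit Defensive.

Import Order.TTheory GRing.Theory Num.Theory.
Import numFieldNormedType.Exports.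

Local Open Scope classical_set_scope.
Local Open Scope ring_scope.

(** * The cross product *)

(** Counting is exact only where no translate is merely grazed. Discreteness of [X] supplies such
    places: a bounded region meets finitely many translates, so all small shifts [t > 0] avoid every
    bad position at once. The sign of the shift is also what makes the windows half-open, since one
    end of an edge survives it and the other does not.

    Three edge directions are needed because the kind of period obtained, [e] or [c], cannot be
    chosen: [e] of one edge and [c] of another may be parallel. Among three edges two are of the
    same kind, and transversal edges have transversal [c]. The multiset reached by taking
    differences may have negative values and need not belong to a tiling; only its support is used,
    which is covered by finitely many translates of the support of [X]. *)

Ltac vec := apply/rowP => ?; rewrite !mxE; ring.
Ltac vecf := apply/rowP => ?; rewrite !mxE; field.

Section CrossProduct.
Variable R : realType.
Implicit Types a b d e p u v w z : plane R.

(** The oriented area. For fixed [e] the linear form [cross e] is the height over lines parallel to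
    [e], so an edge vector, rather than a normal, indexes its two supporting lines. *)
Definition cross a b : R := a 0 0 * b 0 1 - a 0 1 * b 0 0.

Lemma crossC a b : cross a b = - cross b a.
Proof. by rewrite /cross; ring. Qed.

Lemma crossvv a : cross a a = 0.
Proof. by rewrite /cross; ring. Qed.

Lemma crossDr a b c : cross a (b + c) = cross a b + cross a c.
Proof. by rewrite /cross !mxE; ring. Qed.

Lemma crossDl a b c : cross (b + c) a = cross b a + cross c a.
Proof. by rewrite /cross !mxE; ring. Qed.

Lemma crossNr a b : cross a (- b) = - cross a b.
Proof. by rewrite /cross !mxE; ring. Qed.

Lemma crossNl a b : cross (- b) a = - cross b a.
Proof. by rewrite /cross !mxE; ring. Qed.

Lemma crossZr a t b : cross a (t *: b) = t * cross a b.
Proof. by rewrite /cross !mxE; ring. Qed.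

Lemma crossZl a t b : cross (t *: b) a = t * cross b a.
Proof. by rewrite /cross !mxE; ring. Qed.

Lemma cross0r a : cross a 0 = 0.
Proof. by rewrite /cross !mxE; ring. Qed.

Definition crossE :=
  (crossDr, crossDl, crossNr, crossNl, crossZr, crossZl, crossvv, cross0r).

Lemma plane_eq a b : a 0 0 = b 0 0 -> a 0 1 = b 0 1 -> a = b.
Proof.
move=> h0 h1; apply/rowP => i.
have [->|->] : i = 0 \/ i = 1 by case: i => [[|[|//]]] ?; [left|right]; apply/val_inj.
  by [].
by [].
Qed.

Lemma cross_basis u v w : cross u v != 0 ->
  w = (cross w v / cross u v) *: u + (cross u w / cross u v) *: v.
Proof.
by move=> uv; apply: plane_eq; rewrite !mxE; move: uv; rewrite /cross => uv; field.
Qed.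

Lemma const1_neq0 : const_mx 1 != 0 :> plane R.
Proof. by apply/eqP => /rowP/(_ 0)/eqP; rewrite !mxE oner_eq0. Qed.

Definition rot a : plane R := \row_j (if j == 0 then a 0 1 else - a 0 0).

Lemma cross_rot_gt0 a : a != 0 -> 0 < cross (rot a) a.
Proof.
move=> a0; have -> : cross (rot a) a = a 0 0 ^+ 2 + a 0 1 ^+ 2.
  by rewrite /cross !mxE /=; ring.
rewrite lt_neqAle addr_ge0 ?sqr_ge0 // andbT eq_sym paddr_eq0 ?sqr_ge0 //.
rewrite !sqrf_eq0; apply: contra a0 => /andP[/eqP h0 /eqP h1].
by apply/eqP/plane_eq; rewrite !mxE.
Qed.

Lemma cross_parallel e w : e != 0 -> cross e w = 0 -> exists t, w = t *: e.
Proof.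
move=> e0 ew; have := cross_rot_gt0 e0; set h := rot e => he.
have hN : cross h e != 0 by rewrite gt_eqF.
exists (cross h w / cross h e); rewrite {1}(cross_basis w hN).
by rewrite (crossC w) ew oppr0 mul0r scale0r add0r.
Qed.

Lemma exists_transversal e : e != 0 -> exists h, 0 < cross e h.
Proof.
by move=> /cross_rot_gt0 eh; exists (- rot e); rewrite crossNr -crossC.
Qed.

Lemma cross_continuous e : continuous (cross e).
Proof.
move=> z; rewrite /cross.
apply: (@continuousB _ _ _ (fun b => e 0 0 * b 0 1) (fun b => e 0 1 * b 0 0)).
  by apply: (@continuousM _ _ (cst (e 0 0)) (fun b => b 0 1));
    [exact: cst_continuous|exact: coord_continuous].
by apply: (@continuousM _ _ (cst (e 0 1)) (fun b => b 0 0));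
  [exact: cst_continuous|exact: coord_continuous].
Qed.

Lemma coord_le_norm a i : `|a 0 i| <= `|a|.
Proof.
rewrite [leRHS]/Num.norm /= mx_normrE.
by apply: (le_trans _ (le_bigmax _ _ (0, i))).
Qed.

Lemma cross_le_norm a b : `|cross a b| <= 2 * `|a| * `|b|.
Proof.
rewrite /cross (le_trans (ler_normB _ _))// !normrM -mulrA mulr_natl mulr2n.
by apply: lerD; apply: ler_pM; rewrite ?normr_ge0 ?coord_le_norm.
Qed.

Lemma free_cross u v : cross u v != 0 -> free [:: u; v].
Proof.
move=> uv; apply/(@freeP _ _ 2 [tuple u; v]) => k.
rewrite big_ord_recl big_ord1 /= => k0.
have h1 : k 0 = 0.
  have := congr1 (cross^~ v) k0; rewrite /= !crossE mulr0 addr0.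
  rewrite [RHS](_ : _ = 0); last by rewrite /cross !mxE; ring.
  by move/eqP; rewrite mulf_eq0 (negbTE uv) orbF => /eqP.
have h2 : k 1 = 0.
  have := congr1 (cross u) k0; rewrite /= !crossE mulr0 add0r.
  move/eqP; rewrite mulf_eq0 (negbTE uv) orbF => /eqP.
  by congr (k _ = _); apply/val_inj.
move=> i; have [->|->] : i = 0 \/ i = 1 by case: i => [[|[|//]]] ?; [left|right]; apply/val_inj.
  by [].
by [].
Qed.

End CrossProduct.

(** * Rays and faces of convex bodies *)

Section RightNeighbourhoods.
Variable R : realType.

Lemma near0P (P : R -> Prop) :
  (\forall t \near 0^'+, P t) <->
  exists2 e, 0 < e & forall t, 0 < t -> t < e -> P t.
Proof.
split=> [[e /= e0 h]|[e e0 h]].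
  by exists e => // t t0 te; apply: h => //=; rewrite sub0r normrN gtr0_norm.
exists e => //= t; rewrite /= sub0r normrN => te t0; apply: h => //.
by rewrite gtr0_norm in te.
Qed.

Lemma near0_ex (P : R -> Prop) :
  (\forall t \near 0^'+, P t) -> exists2 t, 0 < t & P t.
Proof.
move=> /near0P[e e0 h]; exists (e / 2); first by rewrite divr_gt0.
by apply: h; [rewrite divr_gt0|rewrite ltr_pdivrMr // ltr_pMr // ltr1n].
Qed.

Lemma near0_lt e : 0 < e -> \forall t \near (0 : R)^'+, 0 < t /\ t < e.
Proof. by move=> e0; apply/near0P; exists e. Qed.

Lemma near0_seq (T : eqType) (s : seq T) (P : T -> R -> Prop) :
  (forall x, x \in s -> \forall t \near 0^'+, P x t) ->
  \forall t \near 0^'+, forall x, x \in s -> P x t.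
Proof.
elim: s => [|a s ih] h; first by apply: nearW.
have h1 := h a (mem_head a s).
have h2 := ih (fun x xs => h x (mem_behead (s := a :: s) xs)).
by apply: filterS2 h1 h2 => t pa ps x; rewrite inE => /orP[/eqP ->|/ps].
Qed.

Lemma near0_neq_affine (a b : R) : (a != 0) || (b != 0) ->
  \forall t \near 0^'+, a + t * b != 0.
Proof.
move=> ab; apply/near0P; have [b0|b0] := eqVneq b 0.
  by exists 1 => // t _ _; move: ab; rewrite b0 mulr0 addr0 eqxx orbF.
have [ltr0|ger0] := ltrP 0 (- a / b).
  exists (- a / b) => // t t0 tlt; apply: contraTneq tlt => h.
  have -> : - a / b = t by move/eqP: h; rewrite addr_eq0 => /eqP ->; field.
  by rewrite ltxx.
exists 1 => // t t0 _; apply: contraTneq t0 => h.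
have <- : - a / b = t by move/eqP: h; rewrite addr_eq0 => /eqP ->; field.
by rewrite -leNgt.
Qed.

Lemma near0_ray (V : normedModType R) (U : set V) (z d : V) :
  nbhs z U -> \forall t \near 0^'+, U (z + t *: d).
Proof.
move=> /nbhs_normP[e /= e0 h]; apply/near0P.
have d0 : 0 < `|d| + 1 by rewrite ltr_wpDl.
exists (e / (`|d| + 1)); first by rewrite divr_gt0.
move=> t t0; rewrite ltr_pdivlMr // => te; apply: h => /=.
rewrite opprD addrA subrr sub0r normrN normrZ gtr0_norm //.
by apply: le_lt_trans te; rewrite ler_pM2l // lerDl.
Qed.

End RightNeighbourhoods.

(** * Supporting lines and entering points of a convex body *)

Section Convexity.
Variables (R : realType) (K : set (plane R)).
Implicit Types a b d e p u v w z : plane R.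

Lemma convex_setP : convex_set K ->
  forall a b t, K a -> K b -> 0 <= t -> t <= 1 -> K (a + t *: (b - a)).
Proof.
move=> cK a b t Ka Kb t0 t1.
have := cK b a (Itv01 t0 t1) (mem_set Kb) (mem_set Ka).
rewrite inE; congr K; rewrite /conv /= /unstable.onem.
by vec.
Qed.

Hypothesis cK : convex_set K.
Let convK := convex_setP cK.

(** The homothety with centre [p] and ratio [s] maps a ball around [z] inside [K] to a ball around
    the new point, and convexity keeps the image in [K]. *)
Lemma convex_interior z p s : K p -> K^° z -> 0 < s -> s <= 1 ->
  K^° (p + s *: (z - p)).
Proof.
move=> Kp /nbhs_ballP[e /= e0]; rewrite -ball_normE => h s0 s1.
apply/nbhs_ballP; exists (s * e); first by rewrite /= mulr_gt0.
rewrite -ball_normE => y /= ye.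
have s0' : s != 0 by rewrite gt_eqF.
have -> : y = p + s *: (p + s^-1 *: (y - p) - p).
  by vecf.
apply: convK => //; last exact: ltW.
apply: h => /=.
have -> : z - (p + s^-1 *: (y - p)) = s^-1 *: (p + s *: (z - p) - y).
  by vecf.
by rewrite normrZ gtr0_norm ?invr_gt0 // mulrC ltr_pdivrMr // mulrC.
Qed.

Lemma interior_between p d s t : K p -> K^° (p + s *: d) -> 0 < t -> t <= s ->
  K^° (p + t *: d).
Proof.
move=> Kp Kz t0 ts; have s0 : 0 < s by apply: lt_le_trans ts.
have ts1 : t / s <= 1 by rewrite ler_pdivrMr // mul1r.
have -> : p + t *: d = p + (t / s) *: (p + s *: d - p) by vecf; rewrite gt_eqF.
exact: convex_interior Kp Kz (divr_gt0 t0 s0) ts1.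
Qed.

(** Moving [a] and [b] slightly towards an interior point makes both interior and keeps the strict
    inequalities; the segment between them then crosses the line through [w] parallel to [d]. *)
Lemma cross_level d a b w : K^° !=set0 -> K a -> K b ->
  cross d a < cross d w -> cross d w < cross d b ->
  exists s, K^° (w + s *: d).
Proof.
move=> [z Kz] Ka Kb daw dwb.
have d0 : d != 0.
  by apply: contraTneq daw => ->; rewrite /cross !mxE !mul0r subrr ltxx.
have near_side p q : 0 < cross d q ->
    \forall t \near 0^'+, 0 < cross d q + t * cross d p.
  move=> q0; have := @near0_ray R R^o [set x | 0 < x] (cross d q) (cross d p).
  by apply; exact: lt_nbhsr.
have h1 : \forall t \near 0^'+, cross d (a + t *: (z - a)) < cross d w.
  have := near_side (a - z) (w - a); rewrite crossE crossNr subr_gt0 => /(_ daw).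
  by apply: filterS => t; rewrite !crossE; lra.
have h2 : \forall t \near 0^'+, cross d w < cross d (b + t *: (z - b)).
  have := near_side (z - b) (b - w); rewrite crossE crossNr subr_gt0 => /(_ dwb).
  by apply: filterS => t; rewrite !crossE; lra.
have /near0_ex[t t0 [/andP[ta tb] [_ /ltW t1]]] : \forall t \near 0^'+,
    (cross d (a + t *: (z - a)) < cross d w < cross d (b + t *: (z - b)))
    /\ (0 < t /\ t < 1).
  by apply: filterI (near0_lt ltr01); apply: filterS2 h1 h2 => t -> ->.
have Ka' := convex_interior Ka Kz t0 t1; have Kb' := convex_interior Kb Kz t0 t1.
move: (a + _) (b + _) Ka' Kb' ta tb => a' b' Ka' Kb' ta tb.
pose l := (cross d w - cross d a') / (cross d b' - cross d a').
have D0 : 0 < cross d b' - cross d a' by rewrite subr_gt0 (lt_trans ta).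
have l0 : 0 < l by rewrite divr_gt0 // subr_gt0.
have l1 : l <= 1 by rewrite ler_pdivrMr // mul1r lerD2r ltW.
have KI := convex_interior (interior_subset Ka') Kb' l0 l1.
have [s hs] : exists s, a' + l *: (b' - a') - w = s *: d.
  apply: cross_parallel => //; rewrite !crossE /l; field.
  by rewrite gt_eqF.
by exists s; rewrite -hs addrC subrK.
Qed.

Lemma interior_not_extreme e z : e != 0 -> K^° z ->
  exists2 p, K p & cross e z < cross e p.
Proof.
move=> e0 Kz; have [h eh] := exists_transversal e0.
have /near0_ex[t t0 tK] := near0_ray h Kz.
by exists (z + t *: h) => //; rewrite crossDr crossZr ltrDl mulr_gt0.
Qed.

Definition supp e w := forall z, K z -> cross e z <= cross e w.

Lemma supp_interior e w : e != 0 -> supp e w -> forall z, K^° z -> cross e z < cross e w.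
Proof. by move=> e0 sw z /(interior_not_extreme e0)[p /sw /[swap]]; apply: lt_le_trans. Qed.

(** By convexity the open segment up to [w + s *: d] is interior, so a point moving in direction [d]
    passes into the interior at [w]. Accordingly [entering (- d) w] means that it leaves at [w]. *)
Definition entering d w := [/\ K w, ~ K^° w & exists2 s, 0 < s & K^° (w + s *: d)].

Lemma enteringN d w t : entering d w -> 0 < t -> ~ K (w - t *: d).
Proof.
move=> [Kw nKw [s s0 Ks]] t0 Kt; apply: nKw.
have := @interior_between (w - t *: d) d (t + s) t Kt.
rewrite scalerDl addrA subrK; apply => //.
by rewrite lerDl ltW.
Qed.

Lemma entering_uniq d w t : entering d w -> entering d (w + t *: d) -> t = 0.
Proof.
move=> h1 h2; have [t0|t0|//] := ltrgtP t 0.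
  have := @enteringN _ _ (- t) h1; rewrite oppr_gt0 => /(_ t0).
  by rewrite scaleNr opprK; case: h2.
have := @enteringN _ _ t h2 t0; rewrite addrK.
by case: h1.
Qed.

Lemma boundary_entering d w s : K w -> ~ K^° w -> K^° (w + s *: d) ->
  [/\ 0 < s & entering d w] \/ [/\ s < 0 & entering (- d) w].
Proof.
move=> Kw nKw Ks; have [s0|s0|s0] := ltrgtP s 0.
- right; split => //; split => //; exists (- s); first by rewrite oppr_gt0.
  by rewrite scalerN scaleNr opprK.
- by left; split => //; split => //; exists s.
- by move: Ks; rewrite s0 scale0r addr0.
Qed.

Hypothesis clK : closed K.

Lemma near0_outside w d : ~ K w -> \forall t \near 0^'+, ~ K (w + t *: d).
Proof.
move=> nKw; apply: (@near0_ray R (plane R) (~` K)).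
by apply: open_nbhs_nbhs; split => //; exact: closed_openC.
Qed.

(** The hypothesis excludes a line that only grazes [K] at [w]. Then [K] and its interior agree just
    after [w], which later turns the two inequalities of a tiling into an equality. *)
Lemma near0_ray_mem w d : (K w -> exists s, K^° (w + s *: d)) ->
  \forall t \near 0^'+, (K (w + t *: d) <-> K^° w \/ entering d w) /\
                        (K^° (w + t *: d) <-> K^° w \/ entering d w).
Proof.
move=> h; have [Kw|nKw] := pselect (K w); last first.
  have nK : ~ (K^° w \/ entering d w) by case=> [/interior_subset//|[]].
  have := near0_outside d nKw; apply: filterS => t nKt.
  by split; split => // /interior_subset.
have [iw|niw] := pselect (K^° w).
  have : \forall t \near 0^'+, K^° (w + t *: d).
    by apply: near0_ray; exact: nbhs_interior.
  by apply: filterS => t it; split; split => // _; [left|exact: interior_subset|left].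
have [s Ks] := h Kw; apply/near0P.
have [[s0 ew]|[s0 ew]] := boundary_entering Kw niw Ks.
  exists s; [exact: s0|move=> t t0 ts].
  have it := interior_between Kw Ks t0 (ltW ts).
  have Kt := interior_subset it.
  by split; split=> [_|_]; [right; exact: ew|exact: Kt|right; exact: ew|exact: it].
(* If [w] were entered in both directions, it would lie between two interior points. *)
have nent : ~ (K^° w \/ entering d w).
  case=> [|[_ _ [r r0 Kr]]]; first exact: niw.
  have rs : 0 < r - s by rewrite subr_gt0 (lt_trans s0).
  have l0 : 0 < - s / (r - s) by rewrite divr_gt0 // oppr_gt0.
  have l1 : - s / (r - s) <= 1 by rewrite ler_pdivrMr // mul1r lerDr ltW.
  apply: niw.
  have -> : w = w + s *: d + (- s / (r - s)) *: (w + r *: d - (w + s *: d)).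
    by vecf; rewrite gt_eqF.
  exact: convex_interior (interior_subset Ks) Kr l0 l1.
exists 1; [exact: ltr01|move=> t t0 _].
have nKt : ~ K (w + t *: d) by have := enteringN ew t0; rewrite scalerN opprK.
have nit : ~ K^° (w + t *: d) by move=> /interior_subset.
have iffF (A B : Prop) : ~ A -> ~ B -> (A <-> B) by move=> nA nB; split.
by split; [exact: iffF nKt nent|exact: iffF nit nent].
Qed.

Hypothesis coK : compact K.

Lemma compact_argmax (A : set (plane R)) e : compact A -> A !=set0 ->
  exists2 q, A q & forall z, A z -> cross e z <= cross e q.
Proof.
move=> cA A0; have [q qA hq] := compact_EVT_max A0 cA
  (continuous_subspaceT (@cross_continuous R e)).
by exists q; [exact: set_mem|move=> z Az; apply: hq; exact: mem_set].
Qed.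

Lemma closed_level e c : closed [set z : plane R | cross e z = c].
Proof.
rewrite (_ : [set z | _] = (cross e) @^-1` [set c]) //.
by apply: closed_comp => [z _|]; [exact: cross_continuous|exact: closed_eq].
Qed.

(** The points of [K] of maximal height over [e] lie on one line; the extremes of a transversal
    height [h] on them are the two ends. A face that is a single point has [a = 0]. *)
Lemma face_segment e : e != 0 -> K !=set0 ->
  exists q (a : R), [/\ 0 <= a, supp e q &
    forall z, K z /\ supp e z <-> exists t, [/\ 0 <= t, t <= a & z = q + t *: e]].
Proof.
move=> e0 K0; have [m Km mmax] := compact_argmax e coK K0.
pose A := K `&` [set z | cross e z = cross e m].
have cA : compact A.
  by apply: compact_closedI => //; exact: closed_level.
have A0 : A !=set0 by exists m.
have AP z : A z <-> K z /\ supp e z.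
  split=> -[Kz hz]; split => //; first by move=> y /mmax; rewrite hz.
  by apply/eqP; rewrite eq_le mmax // hz.
have [h eh] := exists_transversal e0.
have he : cross h e < 0 by rewrite crossC oppr_lt0.
have [q Aq qmax] := compact_argmax h cA A0.
have [r Ar rmin] := compact_argmax (- h) cA A0.
have line z : A z -> exists t, z = q + t *: e.
  move=> Az; have [|t ht] := @cross_parallel _ e (z - q) e0.
    by rewrite crossDr crossNr Az.2 Aq.2 subrr.
  by exists t; rewrite -ht addrC subrK.
have [a ha] := line _ Ar; exists q, a; split.
- have := qmax _ Ar; rewrite ha !crossE => h0.
  by rewrite -(nmulr_lle0 _ he); lra.
- by have [] := (AP q).1 Aq.
move=> z; split=> [/AP Az|[t [t0 ta ->]]].
  have [t ht] := line _ Az; exists t; split => //.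
    by have := qmax _ Az; rewrite ht !crossE => h0; rewrite -(nmulr_lle0 _ he); lra.
  have := rmin _ Az; rewrite ht ha !crossE => h0.
  by rewrite -(ler_nM2r he); lra.
apply/AP; split => /=; last by rewrite !crossE mulr0 addr0 Aq.2.
have [a0|a0] := eqVneq a 0.
  have -> : t = 0 by apply/eqP; rewrite eq_le t0 -a0 ta.
  by rewrite scale0r addr0; case: Aq.
have ap : 0 < a by rewrite lt_neqAle eq_sym a0 (le_trans t0).
have := convK Aq.1 Ar.1 (divr_ge0 t0 (ltW ap)).
rewrite ler_pdivrMr // mul1r => /(_ ta); congr K.
by rewrite ha; apply/rowP => ?; rewrite !mxE; field.
Qed.

Lemma exit_point w d : K^° w -> d != 0 ->
  exists2 s, 0 < s & entering (- d) (w + s *: d).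
Proof.
move=> Kw d0; have [h dh] := exists_transversal d0.
have hd : 0 < cross (- h) d by rewrite crossNl -crossC.
pose A := K `&` [set z | cross d z = cross d w].
have cA : compact A by apply: compact_closedI => //; exact: closed_level.
have A0 : A !=set0 by exists w; split => //; exact: interior_subset.
have [q [Kq qw] qmax] := compact_argmax (- h) cA A0.
have [s hs] : exists s, q - w = s *: d.
  by apply: cross_parallel => //; rewrite crossDr crossNr qw subrr.
have {}hs : q = w + s *: d by rewrite -hs addrC subrK.
have farther z : K^° z -> cross d z = cross d w -> cross (- h) z < cross (- h) q.
  move=> Kz zw.
  have /near0_ex[t t0 tK] := near0_ray d Kz.
  have := qmax (z + t *: d); rewrite crossDr (crossZr (- h)) => le1.
  apply: lt_le_trans (le1 _); first by rewrite ltrDl mulr_gt0.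
  by split => //=; rewrite !crossE mulr0 addr0.
have s0 : 0 < s.
  have := farther w Kw erefl; rewrite hs crossDr crossZr ltrDl.
  by rewrite pmulr_lgt0.
exists s => //; rewrite -hs; split => //.
  by move=> Kq'; have := farther q Kq' qw; rewrite ltxx.
by exists s => //; rewrite hs scalerN addrK.
Qed.

End Convexity.

(** * Mass of a discrete multiset *)

Section Bounded.
Variable R : realType.
Implicit Types (A B : set (plane R)) (p d x : plane R).

Lemma bounded_setE A : bounded_set A <-> exists M, forall x, A x -> `|x| <= M.
Proof.
split=> [[M [_ h]]|[M h]].
  by exists (M + 1) => x Ax; apply: (h (M + 1) _ x Ax); rewrite ltrDl.
exists M; split; first exact: num_real.
by move=> r Mr x Ax; apply: le_trans (ltW Mr); exact: h.
Qed.

Lemma bounded_subset A B : A `<=` B -> bounded_set B -> bounded_set A.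
Proof.
by move=> AB /bounded_setE[M h]; apply/bounded_setE; exists M => x /AB; exact: h.
Qed.

Lemma bounded_setU2 A B : bounded_set A -> bounded_set B -> bounded_set (A `|` B).
Proof.
move=> /bounded_setE[M h] /bounded_setE[M' h']; apply/bounded_setE.
exists (Num.max M M') => x; rewrite le_max.
by case=> [/h ->|/h' ->]; rewrite ?orbT.
Qed.

Lemma bounded_diff A B :
  bounded_set A -> bounded_set B ->
  bounded_set [set x | exists a b, [/\ A a, B b & x = a - b]].
Proof.
move=> /bounded_setE[M h] /bounded_setE[M' h']; apply/bounded_setE.
exists (M + M') => _ [a [b [/h Aa /h' Bb ->]]].
by rewrite (le_trans (ler_normB _ _)) // lerD.
Qed.

Lemma bounded_sum A B :
  bounded_set A -> bounded_set B ->
  bounded_set [set x | exists a b, [/\ A a, B b & x = a + b]].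
Proof.
move=> /bounded_setE[M h] /bounded_setE[M' h']; apply/bounded_setE.
exists (M + M') => _ [a [b [/h Aa /h' Bb ->]]].
by rewrite (le_trans (ler_normD _ _)) // lerD.
Qed.

Lemma bounded_scale d (M : R) : bounded_set [set t *: d | t in [set t : R | `|t| <= M]].
Proof.
apply/bounded_setE; exists (M * `|d|) => _ [t /= tM <-].
by rewrite normrZ ler_wpM2r.
Qed.

Lemma bounded_set1 p : bounded_set [set p].
Proof. by apply/bounded_setE; exists `|p| => x ->. Qed.

(* With x ranging over X, the translate x + [a, b) d contains p iff x is in
   seg p d a b. *)
Definition seg p d (a b : R) := [set x | exists t, [/\ a <= t, t < b & x = p - t *: d]].

Lemma bounded_seg p d a b : bounded_set (seg p d a b).
Proof.
apply: bounded_subset (bounded_diff (bounded_set1 p) (bounded_scale d (`|a| + `|b|))).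
move=> x [t [at_ tb ->]]; exists p, (t *: d); split => //; exists t => //=.
rewrite ler_norml; have := ler_norm b; have := ler_norm (- a); rewrite normrN.
have := normr_ge0 a; have := normr_ge0 b; lra.
Qed.

Lemma seg_shift p d s a b : seg (p - s *: d) d a b = seg p d (a + s) (b + s).
Proof.
apply/seteqP; split=> x [t [h1 h2 ->]].
  by exists (t + s); split; [rewrite lerD2r|rewrite ltrD2r|vec].
by exists (t - s); split; [rewrite lerBrDr|rewrite ltrBlDr|vec].
Qed.

Lemma seg_empty p d a : seg p d a a = set0.
Proof. by rewrite -subset0 => x [t [h1 /(le_lt_trans h1)]]; rewrite ltxx. Qed.

Lemma seg_split p d a b c : a <= b -> b <= c ->
  seg p d a c = seg p d a b `|` seg p d b c.
Proof.
move=> ab bc; apply/seteqP; split=> [x [t [at_ tc ->]]|x [|] [t [h1 h2 ->]]].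
- by have [tb|bt] := ltrP t b; [left|right]; exists t.
- by exists t; split => //; apply: lt_le_trans bc.
- by exists t; split => //; apply: le_trans h1.
Qed.

Lemma scalev_inj d (s t : R) : d != 0 -> t *: d = s *: d -> t = s.
Proof.
move=> d0 /eqP; rewrite -subr_eq0 -scalerBl scaler_eq0 (negbTE d0) orbF subr_eq0.
by move/eqP.
Qed.

Lemma seg_disjoint p d a b c e : d != 0 -> b <= c -> seg p d a b `&` seg p d c e = set0.
Proof.
move=> d0 bc; rewrite -subset0 => x [[t [_ tb ->]] [s [cs _ /addrI/oppr_inj]]].
move=> /(scalev_inj d0) ts; move: tb; rewrite ts => sb.
by have := le_lt_trans cs (lt_le_trans sb bc); rewrite ltxx.
Qed.

End Bounded.

Section Mass.
Variables (R : realType) (X : plane R -> nat).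
Implicit Types (A B C : set (plane R)) (p d x v : plane R).

Definition mass A : nat := \big[addn/0%N]_(x \in A) X x.

Lemma cover_countE A p : cover_count A X p = mass [set x | A (p - x)].
Proof.
congr (\big[addn/0%N]_(x \in _) X x); apply/seteqP; split=> x /=.
  by move=> [y Ay <-]; rewrite addrK.
by move=> Ax; exists (p - x) => //; rewrite subrK.
Qed.

Lemma mass_ext A B : (forall x, X x != 0%N -> (A x <-> B x)) -> mass A = mass B.
Proof.
move=> AB; rewrite /mass fsbig_supp [RHS]fsbig_supp; apply: eq_fsbigl.
by apply/seteqP; split=> x /= [h Xx]; split=> //; apply/AB => //; apply/eqP.
Qed.

Lemma mass_set0 A : (forall x, X x != 0%N -> ~ A x) -> mass A = 0%N.
Proof.
move=> h; rewrite (@mass_ext _ set0) ?/mass ?fsbig_set0 // => x /h nA.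
by split => // /nA.
Qed.

Lemma mass_set1 p : mass [set p] = X p.
Proof. exact: fsbig_set1. Qed.

Lemma mass_shift A v : (forall x, X (x + v) = X x) ->
  mass [set x | A (x - v)] = mass A.
Proof.
move=> Xv; rewrite /mass.
have -> : [set x | A (x - v)] = (fun x => x + v) @` A.
  apply/seteqP; split=> [x Ax|_ [y Ay <-]] /=; last by rewrite addrK.
  by exists (x - v) => //; rewrite subrK.
rewrite fsbig_image; last by move=> x y _ _ /addIr.
by apply: eq_fsbigr => x _; rewrite Xv.
Qed.

Hypothesis dX : discrete_multiset X.

Lemma mass_finite A : bounded_set A ->
  mass A = \big[addn/0%N]_(x \in A `&` [set x | X x != 0%N]) X x.
Proof. by move=> bA; apply: mass_ext => x Xx; split=> [|[]]. Qed.

Lemma massU A B : bounded_set A -> bounded_set B -> A `&` B = set0 ->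
  mass (A `|` B) = (mass A + mass B)%N.
Proof.
move=> bA bB AB; rewrite (mass_finite (bounded_setU2 bA bB)).
rewrite (mass_finite bA) (mass_finite bB) setIUl fsbigU //; try exact: dX.
by move=> x [[Ax _] [Bx _]]; have : (A `&` B) x by []; rewrite AB.
Qed.

Lemma mass_le A B : bounded_set B -> A `<=` B -> (mass A <= mass B)%N.
Proof.
move=> bB AB; have -> : B = A `|` (B `\` A) by rewrite setDUK.
rewrite massU ?leq_addr //; first exact: bounded_subset bB.
  by apply: bounded_subset bB; exact: subDsetl.
by rewrite setDE setICA setICr setI0.
Qed.

Lemma mass_gt0 A : bounded_set A -> (0 < mass A)%N <-> exists2 x, A x & X x != 0%N.
Proof.
move=> bA; split=> [|[x Ax Xx]].
  apply: contraTP => h; rewrite -leqNgt leqn0; apply/eqP/mass_set0 => x Xx Ax.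
  by apply: h; exists x.
apply: (@leq_trans (mass [set x])); first by rewrite mass_set1 lt0n.
by apply: mass_le => // y ->.
Qed.

(** Only finitely many points of [X] lie in [C], so thresholds that depend on the point have a
    positive minimum. *)
Lemma near0_supp C (P : plane R -> R -> Prop) : bounded_set C ->
  (forall x, C x -> X x != 0%N -> \forall t \near 0^'+, P x t) ->
  \forall t \near 0^'+, forall x, C x -> X x != 0%N -> P x t.
Proof.
move=> bC h; have /finite_seqP[s hs] := dX bC.
have sE x : x \in s <-> C x /\ X x != 0%N.
  have -> : x \in s <-> [set` s] x by [].
  by rewrite -hs.
have := @near0_seq R _ s P (fun x xs => h x ((sE x).1 xs).1 ((sE x).1 xs).2).
by apply: filterS => t ht x Cx Xx; apply: ht; apply/sE.
Qed.

Lemma mass_near0 (A : R -> set (plane R)) B C : bounded_set C ->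
  (forall t, 0 < t -> t < 1 -> A t `<=` C) -> B `<=` C ->
  (forall x, C x -> X x != 0%N -> \forall t \near 0^'+, A t x <-> B x) ->
  \forall t \near 0^'+, mass (A t) = mass B.
Proof.
move=> bC AC BC /(near0_supp bC); apply: filterS2 (near0_lt ltr01) => t [t0 t1] h.
apply: mass_ext => x Xx; have [Cx|nCx] := pselect (C x); first exact: h.
by split=> [/(AC _ t0 t1)|/BC].
Qed.

End Mass.

(** * Counting translates near a point *)

Section Counting.
Variables (R : realType) (K : set (plane R)) (X : plane R -> nat).
Implicit Types (a b d e p u v w x y z : plane R).
Hypotheses (coK : compact K) (cK : convex_set K).
Hypothesis dX : discrete_multiset X.

Lemma compact_plane_closed : closed K.
Proof. by apply: compact_closed => //; exact: norm_hausdorff. Qed.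

Let clK := compact_plane_closed.

Let reach z d := [set x | exists2 t, `|t| <= 1 & K (z + t *: d - x)].

Lemma bounded_reach z d : bounded_set (reach z d).
Proof.
apply: bounded_subset (bounded_diff (bounded_sum (bounded_set1 z) (bounded_scale d 1))
  (compact_bounded coK)) => x [t t1 Kx].
exists (z + t *: d), (z + t *: d - x); split => //; last by rewrite subKr.
by exists z, (t *: d); split => //; exists t.
Qed.

Lemma bounded_reach0 z : bounded_set [set x | K (z - x)].
Proof.
apply: bounded_subset (bounded_reach z 0) => x Kx.
by exists 0; rewrite ?normr0 // scaler0 addr0.
Qed.

(** The genericity condition on a line: no translate containing [z] is merely grazed. Translates
    with [z] in the interior satisfy it with [s = 0]. *)
Definition crossing z d :=
  forall x, X x != 0%N -> K (z - x) -> exists s, K^° (z - x + s *: d).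

Definition in_count z d := mass X [set x | entering K d (z - x)].

Definition closed_count z := mass X [set x | K (z - x)].

Definition open_count z := mass X [set x | K^° (z - x)].

Lemma crossingN z d : crossing z d -> crossing z (- d).
Proof.
by move=> h x Xx /(h x Xx)[s hs]; exists (- s); rewrite scalerN scaleNr opprK.
Qed.

(** Of the translates containing [z], those with [z] interior stay, those entered become interior,
    and the others are left at once. *)
Lemma near0_ray_count z d : crossing z d ->
  \forall t \near 0^'+,
    closed_count (z + t *: d) = (open_count z + in_count z d)%N /\
    open_count (z + t *: d) = (open_count z + in_count z d)%N.
Proof.
move=> h; pose C := reach z d; have bC : bounded_set C := bounded_reach z d.
have intC : [set x | K^° (z - x)] `<=` C.
  by move=> x /interior_subset Kx; exists 0; rewrite ?normr0 // scale0r addr0.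
have entC : [set x | entering K d (z - x)] `<=` C.
  by move=> x [Kx _ _]; exists 0; rewrite ?normr0 // scale0r addr0.
rewrite /closed_count /open_count /in_count -massU //; first last.
- by rewrite -subset0 => x [ix [_]].
- exact: bounded_subset bC.
- exact: bounded_subset bC.
have comm (t : R) (x : plane R) : z + t *: d - x = z - x + t *: d by rewrite addrAC.
apply: filterI; apply: (mass_near0 dX bC).
- by move=> t t0 t1 x Kx; exists t => //; rewrite ger0_norm ltW.
- by move=> x [/intC|/entC].
- move=> x Cx /h/(near0_ray_mem cK clK); apply: filterS => t [h1 h2].
  by rewrite /= comm.
- by move=> t t0 t1 x /interior_subset Kx; exists t => //; rewrite ger0_norm ltW.
- by move=> x [/intC|/entC].
- move=> x Cx /h/(near0_ray_mem cK clK); apply: filterS => t [h1 h2].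
  by rewrite /= comm.
Qed.

Lemma level_crossing z d : K^° !=set0 ->
  (forall x, X x != 0%N -> K (z - x) ->
    exists a b, [/\ K a, K b, cross d a < cross d (z - x) & cross d (z - x) < cross d b]) ->
  crossing z d.
Proof.
by move=> K0 h x Xx /(h x Xx)[a [b [Ka Kb da db]]]; exact: (cross_level cK K0 Ka Kb).
Qed.

Lemma near0_interior_mass_le z d :
  \forall t \near 0^'+,
    (open_count z <= open_count (z + t *: d))%N.
Proof.
have bC : bounded_set [set x | K^° (z - x)].
  by apply: bounded_subset (bounded_reach0 z) => x /interior_subset.
have hh : forall x, [set x | K^° (z - x)] x -> X x != 0%N ->
    \forall t \near 0^'+, K^° (z + t *: d - x).
  move=> x /= ix _; have := @near0_ray R (plane R) _ (z - x) d (nbhs_interior ix).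
  by apply: filterS => t; rewrite addrAC.
have := near0_supp dX bC hh; apply: filterS => t ht.
pose Z := [set x | K^° (z - x)] `&` [set x | X x != 0%N].
rewrite [leqLHS](@mass_ext _ X _ Z); last by move=> x Xx; split=> [|[]].
apply: (mass_le dX).
  by apply: bounded_subset (bounded_reach0 (z + t *: d)) => x /interior_subset.
by move=> x [ix Xx]; exact: ht.
Qed.

Lemma near0_mass_le z d :
  \forall t \near 0^'+,
    (closed_count (z + t *: d) <= closed_count z)%N.
Proof.
pose C := reach z d; have bC : bounded_set C := bounded_reach z d.
have hh x : C x -> X x != 0%N ->
    \forall t \near 0^'+, K (z + t *: d - x) -> K (z - x).
  move=> Cx _; have [Kx|nKx] := pselect (K (z - x)); first exact: nearW.
  by have := near0_outside clK d nKx; apply: filterS => t; rewrite addrAC.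
have := near0_supp dX bC hh; apply: filterS2 (near0_lt ltr01) => t [t0 t1] ht.
pose Z := [set x | K (z + t *: d - x)] `&` [set x | X x != 0%N].
rewrite [leqLHS](@mass_ext _ X _ Z); last by move=> x Xx; split=> [|[]].
apply: (mass_le dX); first exact: bounded_reach0.
move=> x [ix Xx]; apply: ht => //.
by exists t => //; rewrite ger0_norm ltW.
Qed.

Variable k : nat.
Hypothesis tiling : is_kfold_translative_tiling k K X.

Lemma tiling_mass z : (k <= closed_count z)%N /\ (open_count z <= k)%N.
Proof. by have := tiling.2 z; rewrite !cover_countE. Qed.

(** Just after [z] both counts agree, hence equal [k], in direction [d] as well as [- d]. Cancelling
    the translates with [z] in the interior leaves the claim. *)
Lemma tiling_balance z d : crossing z d -> in_count z d = in_count z (- d).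
Proof.
have main d' : crossing z d' -> (open_count z + in_count z d')%N = k.
  move=> /near0_ray_count/near0_ex[t _ [h1 h2]].
  have [le1 le2] := tiling_mass (z + t *: d').
  by apply/eqP; rewrite eqn_leq -{1}h2 le2 -h1.
move=> h; have := main d h; rewrite -(main (- d) (crossingN h)).
exact: addnI.
Qed.

End Counting.

(** * Edges of a tile *)

Section Windows.
Variables (R : realType) (X : plane R -> nat).
Hypothesis dX : discrete_multiset X.
Implicit Types (p e c x : plane R).

Lemma bounded_nat_max (T : Type) (t0 : T) (g : T -> nat) (M : nat) : (forall t, (g t <= M)%N) ->
  exists t, forall u, (g u <= g t)%N.
Proof.
move=> gM; pose P n := `[< exists t, g t = n >].
have exP : exists n, P n by exists (g t0); apply/asboolP; exists t0.
have ubP n : P n -> (n <= M)%N by move=> /asboolP[t <-].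
case: (ex_maxnP exP ubP) => n /asboolP[t <-] h.
by exists t => u; apply: h; apply/asboolP; exists u.
Qed.

(* Sliding a window of maximal mass: both windows of length b inside a window of
   length a > b of no larger mass contain the same points, so the points of the
   maximal window also lie in a disjoint translate of it. *)
Lemma unequal_windows (a b : R) e c (M : nat) : e != 0 -> 0 <= b -> b < a ->
  (forall p, (mass X (seg p e 0%R b) <= M)%N) ->
  (forall p, mass X (seg p e 0 a) = mass X (seg (p + c) e 0 b)) ->
  forall x, X x = 0%N.
Proof.
move=> e0 b0 ba gM ab; pose g p := mass X (seg p e 0 b).
have [p0 gp0] := bounded_nat_max (0 : plane R) gM.
have d0 : 0 < a - b by rewrite subr_gt0.
have shift_max p s : g p = g p0 -> 0 <= s -> s <= a - b -> g (p + s *: e + c) = g p0.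
  move=> gp s0 sd; apply/eqP; rewrite eqn_leq [(_ <= g p0)%N]gp0 /= -gp /g -ab.
  apply: (mass_le dX (bounded_seg _ _ _ _)) => x [t [t0 tb ->]].
  exists (t + s); split; [exact: addr_ge0|by lra|by vec].
(* The range of shifts with maximal mass grows by [a - b] at the cost of one translation by [c]. *)
have slide (n : nat) : exists p, forall s, 0 <= s -> s <= n%:R * (a - b) ->
    g (p + s *: e) = g p0.
  elim: n => [|n [p hp]].
    exists p0 => s s0; rewrite mul0r => s1.
    by have -> : s = 0; [lra|rewrite scale0r addr0].
  exists (p + c) => s s0 sn.
  have nd0 : 0 <= n%:R * (a - b) by rewrite mulr_ge0 // ltW.
  have [sd|ds] := lerP s (a - b).
    have := shift_max _ s (hp 0 (lexx 0) nd0) s0 sd.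
    by congr (g _ = _); vec.
  have h0 : 0 <= s - (a - b) by rewrite subr_ge0 ltW.
  have h1 : s - (a - b) <= n%:R * (a - b) by move: sn; rewrite -natr1; lra.
  have := shift_max _ (a - b) (hp _ h0 h1) (ltW d0) (lexx _).
  by congr (g _ = _); vec.
have [n bn] : exists n : nat, b <= n%:R * (a - b).
  exists (Num.truncn (b / (a - b))).+1.
  by rewrite -ler_pdivrMr // ltW // truncnS_gt.
have [p hp] := slide n.
(* A point lost between consecutive positions would lie, together with the whole maximal window at
   the later position, in one window of length [a], whose mass would then exceed the maximum. *)
have keep (j : nat) : (j <= n)%N -> forall x, X x != 0%N -> seg p e 0 b x ->
    seg (p + (j%:R * (a - b)) *: e) e 0 b x.
  elim: j => [|j ih] jn x Xx px; first by rewrite mul0r scale0r addr0.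
  have {}ih := ih (ltnW jn) x Xx px.
  have jn1 : j%:R + 1 <= n%:R :> R by rewrite natr1 ler_nat.
  have jd : j%:R * (a - b) + (a - b) <= n%:R * (a - b).
    by rewrite -[X in _ + X]mul1r -mulrDl ler_pM2r.
  have j0 : 0 <= j%:R * (a - b) by rewrite mulr_ge0 // ?ler0n ltW.
  have gj1 := hp (j.+1%:R * (a - b)); rewrite -natr1 mulrDl mul1r in gj1 *.
  have {}gj1 := gj1 (addr_ge0 j0 (ltW d0)) jd.
  move: gj1 ih; move: (j%:R * (a - b)) => s gj1 ih.
  apply: contrapT => nx.
  have := gp0 (p + (s + (a - b)) *: e + c); rewrite /g -ab.
  have sub : [set x] `|` seg (p + (s + (a - b)) *: e) e 0 b `<=`
      seg (p + (s + (a - b)) *: e) e 0 a.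
    move=> y [->|[t [t0 tb ->]]]; last first.
      by exists t; split => //; apply: lt_trans ba.
    case: ih => t [t0 tb ->]; exists (t + (a - b)).
    by split; [lra|lra|vec].
  apply/negP; rewrite -ltnNge; apply: leq_trans (mass_le dX (bounded_seg _ _ _ _) sub).
  rewrite massU //; [|exact: bounded_set1|exact: bounded_seg|].
    by rewrite mass_set1 [X in (_ < _ + X)%N]gj1 -add1n leq_add2r lt0n.
  by rewrite -subset0 => y [-> /nx].
have gp00 : g p0 = 0%N.
  have nd0 : 0 <= n%:R * (a - b) by rewrite mulr_ge0 // ltW.
  rewrite -(hp 0 (lexx _) nd0).
  apply: mass_set0 => x Xx; rewrite scale0r addr0 => px.
  have [t [t0 tb xt]] := px; have [t' [t'0 t'b xt']] := keep n (leqnn _) x Xx px.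
  have : (t + n%:R * (a - b)) *: e = t' *: e.
    have h : p - t *: e = p + (n%:R * (a - b)) *: e - t' *: e by rewrite -xt.
    transitivity (p + (n%:R * (a - b)) *: e - (p - t *: e)); first by vec.
    by rewrite h; vec.
  move=> /(scalev_inj e0); lra.
move=> x; apply/eqP; rewrite -leqn0 -gp00.
apply: leq_trans (gp0 (x + c)); rewrite /g -ab -mass_set1.
apply: (mass_le dX (bounded_seg _ _ _ _)) => y ->.
by exists 0; split => //; [exact: le_lt_trans ba|rewrite scale0r subr0].
Qed.

Lemma mass_seg_near0 p e (s : R) :
  \forall t \near 0^'+, mass X (seg p e s (s + t)) = X (p - s *: e).
Proof.
have [->|e0] := eqVneq e 0.
  apply: filterS (near0_lt ltr01) => t [t0 _]; rewrite -mass_set1.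
  congr mass; apply/seteqP; split=> [x [r [_ _ ->]]|x ->] /=.
    by rewrite !scaler0.
  by exists s; split => //; rewrite ltrDl.
rewrite -mass_set1; apply: (mass_near0 dX (bounded_seg p e s (s + 1))).
- by move=> t t0 t1 x [r [sr rt ->]]; exists r; split => //; lra.
- by move=> x ->; exists s; split => //; lra.
move=> _ [r [sr r1 ->]] _; have [->|rs] := eqVneq r s.
  apply: filterS (near0_lt ltr01) => t [t0 _]; split => // _.
  by exists s; split => //; lra.
have sr' : 0 < r - s by rewrite subr_gt0 lt_neqAle eq_sym rs.
apply: filterS (near0_lt sr') => t [t0 tr]; split.
  move=> [r' [_ r't /addrI/oppr_inj/(scalev_inj e0) rr']].
  by move: r't; rewrite -rr'; lra.
by move=> /addrI/oppr_inj/(scalev_inj e0)/eqP; rewrite (negbTE rs).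
Qed.

(* Here e is an edge vector of K and c the translation carrying the opposite edge
   onto that edge: along every line R e, the translates of both edges by X cover
   each point equally often. *)
Definition balanced e c := forall p, mass X (seg p e 0 1) = mass X (seg (p + c) e 0 1).

(** Sliding a window at [r] by a small [t] against [e] loses its closed end [r] and gains [r - e].
    Doing so with both windows and subtracting the two balance equations leaves
    [(1 - T_e)(1 - T_c) X = 0] pointwise. *)
Lemma balanced_periodic e c p : e != 0 -> balanced e c ->
  (X p + X (p + c - e) = X (p + c) + X (p - e))%N.
Proof.
move=> e0 bal.
have step r : \forall t \near 0^'+,
    (X r + mass X (seg (r - t *: e) e 0%R 1%R) = mass X (seg r e 0%R 1%R) + X (r - e))%N.
  have := mass_seg_near0 r e 1; rewrite scale1r; apply: filterS3 (near0_lt ltr01)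
    (mass_seg_near0 r e 0) => t [t0 t1].
  rewrite scale0r subr0 add0r => h0 h1; rewrite -h0 -h1 seg_shift add0r.
  rewrite -!massU //; try exact: bounded_seg; last 2 first.
  - exact: seg_disjoint.
  - exact: seg_disjoint.
  by rewrite -!seg_split //; lra.
have [t _ [h1 h2]] := near0_ex (filterI (step p) (step (p + c))).
have comm : p - t *: e + c = p + c - t *: e by vec.
move: h1 h2; rewrite (bal p) (bal (p - t *: e)) comm.
move: (mass X _) (mass X _) (X p) (X (p - e)) (X (p + c)) (X (p + c - e)) => A B x1 x2 x3 x4.
by lia.
Qed.

End Windows.

(** * Balance of opposite faces in a tiling *)

Section EdgeCounts.
Variables (R : realType) (K : set (plane R)) (X : plane R -> nat).
Implicit Types (a b d e p q r u v w x y z : plane R).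
Hypotheses (coK : compact K) (cK : convex_set K) (K0 : K^° !=set0).
Hypothesis dX : discrete_multiset X.
Let clK := compact_plane_closed coK.
Let Kn0 : K !=set0.
Proof. by have [z /interior_subset] := K0; exists z. Qed.

(** A line in direction [d] can graze a translate only at the extreme heights of [K], attained at
    [m1] and [m2]. Shifting along the transversal [e] changes the height, so each nearby [x]
    excludes at most two values of [t]. *)
Lemma near0_crossing p e d : cross d e != 0 ->
  \forall t \near 0^'+, crossing K X (p + t *: e) d.
Proof.
move=> de; have [m1 Km1 max1] := compact_argmax d coK Kn0.
have [m2 Km2 max2] := compact_argmax (- d) coK Kn0.
have hh x : [set x | exists2 t, `|t| <= 1 & K (p + t *: e - x)] x -> X x != 0%N ->
  \forall t \near 0^'+, cross d (p - x - m1) + t * cross d e != 0 /\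
                        cross d (p - x - m2) + t * cross d e != 0.
  by move=> _ _; apply: filterI; apply: near0_neq_affine; rewrite de orbT.
have := near0_supp dX (bounded_reach coK p e) hh.
apply: filterS2 (near0_lt ltr01) => t [t0 t1] ht.
apply: (level_crossing cK K0) => x Xx Kx; exists m2, m1.
have Cx : exists2 t, `|t| <= 1 & K (p + t *: e - x).
  by exists t => //; rewrite ger0_norm ltW.
have [n1 n2] := ht x Cx Xx.
split => //.
  have := max2 _ Kx; rewrite !crossNl lerN2 le_eqVlt => /orP[/eqP h|//].
  by move: n2; rewrite !crossE h !crossE; move/eqP; lra.
have := max1 _ Kx; rewrite le_eqVlt => /orP[/eqP h|//].
by move: n1; rewrite !crossE -h !crossE; move/eqP; lra.
Qed.

(** As [d] points inwards from the face on the side of [u], only translates met on that face are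
    counted: strictly between the two faces the line along [e] meets the interior and small [t]
    avoids the boundary, and at the opposite face [d] leads outwards. *)
Lemma near0_face_count p e u d q (l : R) : e != 0 -> u = e \/ u = - e -> cross u d < 0 ->
  0 <= l ->
  (forall z, K z /\ supp K u z <-> exists t, [/\ 0 <= t, t <= l & z = q + t *: e]) ->
  \forall t \near 0^'+, in_count K X (p + t *: e) d = mass X (seg (p - q) e 0 l).
Proof.
move=> e0 ue ud l0 face.
have u0 : u != 0 by case: ue => ->; rewrite ?oppr_eq0.
have ue0 : cross u e = 0 by case: ue => ->; rewrite !crossE ?oppr0.
have [Kq sq] : K q /\ supp K u q by apply/face; exists 0; rewrite scale0r addr0.
have de : cross d e != 0.
  apply: contraTneq ud => de; rewrite -leNgt.
  by case: ue => ->; rewrite ?crossNl crossC de !oppr0.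
pose C := [set x | exists2 t, `|t| <= 1 & K (p + t *: e - x)].
have bC : bounded_set (C `|` seg (p - q) e 0 l).
  by apply: bounded_setU2; [exact: bounded_reach|exact: bounded_seg].
apply: (mass_near0 dX bC).
- by move=> t t0 t1 x [Kx _ _]; left; exists t => //; rewrite ger0_norm ltW.
- by move=> x; right.
move=> x _ Xx; have [w wdef] : exists w, w = p - x by exists (p - x).
have wE t : p + t *: e - x = w + t *: e by rewrite wdef addrAC.
have segE : seg (p - q) e 0 l x <-> exists s, [/\ 0 <= s, s < l & w = q + s *: e].
  split=> -[s [s0 sl h]]; exists s; split => //.
    by rewrite wdef h; vec.
  have -> : x = p - w by rewrite wdef subKr.
  by rewrite h; vec.
have [wq|wq] := eqVneq (cross u w) (cross u q).
  have [s ws] : exists s, w = q + s *: e.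
    have [|s hs] := @cross_parallel _ e (w - q) e0.
      have : cross u (w - q) = 0 by rewrite !crossE wq subrr.
      by case: ue => ->; rewrite ?crossNl // => /eqP; rewrite oppr_eq0 => /eqP.
    by exists s; rewrite -hs addrC subrK.
  have ent : \forall t \near 0^'+, entering K d (w + t *: e) <-> 0 <= s + t <= l.
    apply: filterS (near0_crossing p de) => t /(_ x Xx); rewrite wE => cr.
    have lev : cross u (w + t *: e) = cross u q by rewrite crossDr crossZr ue0 mulr0 addr0.
    have memE : K (w + t *: e) <-> 0 <= s + t <= l.
      transitivity (K (w + t *: e) /\ supp K u (w + t *: e)).
        by split=> [Kw|[]//]; split => // z /sq; rewrite lev.
      rewrite face ws; split=> [[r [r0 rl]]|/andP[h1 h2]].
        rewrite -addrA -scalerDl => /addrI/(scalev_inj e0) ->.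
        by rewrite r0.
      by exists (s + t); split => //; vec.
    rewrite -memE; split=> [[]//|Kw]; split => //.
      by move=> /(supp_interior u0 sq); rewrite lev ltxx.
    have [r hr] := cr Kw; exists r => //.
    have := supp_interior u0 sq hr; rewrite crossDr lev crossZr gtrDl.
    by rewrite nmulr_llt0.
  (* A positive shift keeps a point at the near end [s = 0] on the face and pushes one at the far
     end [s = l] off it; hence the half-open window. *)
  have bnd : \forall t \near 0^'+, (0 <= s + t <= l) = (0 <= s < l).
    have [s0|s0] := ltrP s 0.
      have ns : 0 < - s by rewrite oppr_gt0.
      by apply: filterS (near0_lt ns) => t [t0 ts]; lra.
    have [sl|sl] := ltrP s l.
      have ns : 0 < l - s by rewrite subr_gt0.
      by apply: filterS (near0_lt ns) => t [t0 ts]; lra.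
    by apply: filterS (near0_lt ltr01) => t [t0 ts]; lra.
  apply: filterS2 ent bnd => t h1 h2; rewrite /= wE h1 h2 segE.
  split=> [/andP[? ?]|[r [r0 rl]]]; first by exists s.
  by rewrite ws => /addrI/(scalev_inj e0) ->; rewrite r0.
have nseg : ~ seg (p - q) e 0 l x.
  by rewrite segE => -[s [_ _ h]]; move: wq; rewrite h crossDr crossZr ue0 mulr0 addr0 eqxx.
suff : \forall t \near 0^'+, ~ entering K d (w + t *: e).
  by apply: filterS => t h; rewrite /= wE; split.
have [[b Kb bw]|nb] := pselect (exists2 b, K b & cross u b < cross u w); last first.
  apply: nearW => t [_ _ [s s0 /interior_subset Ks]]; apply: nb.
  exists (w + t *: e + s *: d) => //.
  by rewrite !(crossDr, crossZr) ue0 mulr0 addr0 gtrDl pmulr_rlt0.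
have [wl|wl] := ltrP (cross u q) (cross u w).
  apply: nearW => t [Kw _ _]; have := sq _ Kw.
  by rewrite crossDr crossZr ue0 mulr0 addr0 leNgt wl.
have ww : cross u w < cross u q by rewrite lt_neqAle wq.
have [s hs] : exists s, K^° (w + s *: e).
  have [s] := cross_level cK K0 Kb Kq bw ww.
  case: ue => -> hs; first by exists s.
  by exists (- s); rewrite scaleNr -scalerN.
have hw : K w -> exists s, K^° (w + s *: e) by exists s.
by have := near0_ray_mem cK clK hw; apply: filterS => t [h1 h2] [/h1/h2].
Qed.

Variable k : nat.
Hypothesis tiling : is_kfold_translative_tiling k K X.

(** At a generic point just after [p + q] along [e], translates are entered in direction [- d]
    through top faces and in direction [d] through bottom faces; [tiling_balance] equates the two
    counts. *)
Lemma face_balance e q r (l m : R) : e != 0 -> 0 <= l -> 0 <= m ->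
  (forall z, K z /\ supp K e z <-> exists t, [/\ 0 <= t, t <= l & z = q + t *: e]) ->
  (forall z, K z /\ supp K (- e) z <-> exists t, [/\ 0 <= t, t <= m & z = r + t *: e]) ->
  forall p, mass X (seg p e 0 l) = mass X (seg (p + (q - r)) e 0 m).
Proof.
move=> e0 l0 m0 top bot p; have [d ed] := exists_transversal e0.
have de : cross d e != 0 by rewrite crossC oppr_eq0 gt_eqF.
have top_count := @near0_face_count (p + q) e e (- d) q l e0 (or_introl erefl) _ l0 top.
have bot_count := @near0_face_count (p + q) e (- e) d r m e0 (or_intror erefl) _ m0 bot.
move: top_count bot_count; rewrite crossNr crossNl oppr_lt0 ed => /(_ isT) + /(_ isT).
rewrite addrK -addrA => tc bc.
have [t _ [h1 [h2 h3]]] := near0_ex (filterI (near0_crossing (p + q) de) (filterI tc bc)).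
by rewrite -h2 -h3; apply/esym/(tiling_balance coK cK dX tiling).
Qed.

(** If [z + [0, s) e] is interior to [K], every [x] in a window of length [s] at [p] has [p + z] in
    the interior of [K + x], so such windows have mass at most [k]. Longer ones are cut up. *)
Lemma window_bound e (l : R) : e != 0 -> 0 <= l ->
  exists M : nat, forall p, (mass X (seg p e 0%R l) <= M)%N.
Proof.
move=> e0 l0; have [z Kz] := K0.
have [s s0 hs] := (near0P _).1 (@near0_ray R (plane R) _ z e (nbhs_interior Kz)).
have small p : (mass X (seg p e 0%R s) <= k)%N.
  apply: leq_trans (tiling_mass tiling (p + z)).2.
  apply: (mass_le dX).
    by apply: bounded_subset (bounded_reach0 coK (p + z)) => x /interior_subset.
  move=> _ [t [t0 ts ->]] /=; rewrite (_ : _ - _ = z + t *: e); last by vec.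
  move: t0; rewrite le_eqVlt => /orP[/eqP <-|t0]; first by rewrite scale0r addr0.
  exact: hs.
have multi (n : nat) p : (mass X (seg p e 0%R (n%:R * s)) <= n * k)%N.
  elim: n => [|n ih].
    by rewrite mul0r seg_empty mass_set0 // => x _ [].
  rewrite (@seg_split _ _ _ _ (n%:R * s)); first last.
  - by rewrite ler_pM2r // ler_nat.
  - by rewrite mulr_ge0 // ltW.
  rewrite massU //; try exact: bounded_seg; last exact: seg_disjoint.
  rewrite mulSn addnC leq_add // -natr1 mulrDl mul1r.
  by have := small (p - (n%:R * s) *: e); rewrite seg_shift add0r addrC.
exists ((Num.truncn (l / s)).+1 * k)%N => p.
apply: leq_trans (multi _ _); apply: (mass_le dX (bounded_seg _ _ _ _)).
move=> x [t [t0 tl ->]]; exists t; split => //; apply: lt_le_trans tl _.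
by rewrite -ler_pdivrMr // ltW // truncnS_gt.
Qed.

End EdgeCounts.

(** * Tiles are polygons *)

Section Polygon.
Variables (R : realType) (K : set (plane R)).
Implicit Types (a b d e p q r u v w x y z : plane R).
Hypotheses (coK : compact K) (cK : convex_set K) (K0 : K^° !=set0).
Let clK := compact_plane_closed coK.
Let Kn0 : K !=set0.
Proof. by have [z /interior_subset] := K0; exists z. Qed.

(** Polygonality in a form that passes to subsets and finite unions. The points of [V] absorb
    degenerate cases, and no face is required to have positive length yet. *)
Definition few_faces (S : set (plane R)) := exists V ds : seq (plane R),
  (forall e, e \in ds -> e != 0) /\
  (forall w, S w -> w \in V \/ exists2 e, e \in ds & supp K e w).

Lemma few_facesS (S S' : set (plane R)) : S `<=` S' -> few_faces S' -> few_faces S.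
Proof. by move=> sub [V [ds [h1 h2]]]; exists V, ds; split => // w /sub/h2. Qed.

Lemma few_facesU (S S' : set (plane R)) :
  few_faces S -> few_faces S' -> few_faces (S `|` S').
Proof.
move=> [V [ds [h1 h2]]] [V' [ds' [h1' h2']]]; exists (V ++ V'), (ds ++ ds').
split=> [e|w]; first by rewrite mem_cat => /orP[/h1|/h1'].
case=> [/h2|/h2'] [wV|[e es se]]; rewrite ?mem_cat ?wV ?orbT; try by left.
  by right; exists e => //; rewrite mem_cat es.
by right; exists e => //; rewrite mem_cat es orbT.
Qed.

Lemma few_faces_seq (T : eqType) (s : seq T) (F : T -> set (plane R)) :
  (forall i, few_faces (F i)) -> few_faces [set w | exists2 i, i \in s & F i w].
Proof.
move=> h; elim: s => [|j s ih].
  by exists [::], [::]; split => // w [].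
apply: few_facesS (few_facesU (h j) ih) => w [i].
by rewrite inE => /orP[/eqP ->|is_] Fi; [left|right; exists i].
Qed.

(** A line in direction [d] enters a convex set at most once. *)
Lemma few_faces_level d b :
  few_faces [set w | entering K d w /\ cross d w = cross d b].
Proof.
have [->|d0] := eqVneq d 0.
  exists [::], [::]; split => // w [[_ nKw [s _]]].
  by rewrite scaler0 addr0.
have [[w [ew wb]]|nw] := pselect (exists w, entering K d w /\ cross d w = cross d b).
  exists [:: w], [::]; split => // w' [ew' wb']; left; rewrite inE; apply/eqP.
  have [t ht] : exists t, w' - w = t *: d.
    by apply: cross_parallel => //; rewrite !crossE wb wb' subrr.
  have w'E : w' = w + t *: d by rewrite -ht addrC subrK.
  by move: ew'; rewrite w'E => /(entering_uniq cK ew) ->; rewrite scale0r addr0.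
by exists [::], [::]; split => // w hw; case: nw; exists w.
Qed.

(** If [K] had points strictly on both sides of the chord, its line would meet the interior; the
    given point of the chord would then lie between an interior point and one end of the chord, and
    be interior. *)
Lemma supp_chord p1 p3 s : K p1 -> K p3 -> 0 < s -> s < 1 ->
  ~ K^° (p1 + s *: (p3 - p1)) ->
  supp K (p3 - p1) (p1 + s *: (p3 - p1)) \/ supp K (- (p3 - p1)) (p1 + s *: (p3 - p1)).
Proof.
move=> K1 K3 s0 s1; set e := p3 - p1; set p2 := p1 + _ => n2.
apply: contrapT => /not_orP[]; rewrite /supp.
move=> /existsNP[b /not_implyP[Kb]] /negP; rewrite -ltNge => eb.
move=> /existsNP[a /not_implyP[Ka]] /negP; rewrite -ltNge !crossNl ltrN2 => ea.
have [r hr] := cross_level cK K0 Ka Kb ea eb; apply: n2.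
have [r0|r0|r0] := ltrgtP r 0; last by move: hr; rewrite r0 scale0r addr0.
  have h : p3 + (1 - s - r) *: - e = p2 + r *: e by rewrite /p2 /e; vec.
  have -> : p2 = p3 + (1 - s) *: - e by rewrite /p2 /e; vec.
  apply: (interior_between cK K3 (s := 1 - s - r)); [by rewrite h|lra|lra].
have h : p1 + (s + r) *: e = p2 + r *: e by rewrite /p2; vec.
by apply: (interior_between cK K1 (s := s + r)); [rewrite h|lra|lra].
Qed.

(** Points where a line in direction [d] enters [K] while leaving [K + y]. As functions of the
    height, the entry position is convex and the exit position concave, so three points of
    coincidence are collinear. *)
Definition meeting d y := [set w | entering K d w /\ entering K (- d) (w - y)].

Lemma meeting_chord d y p1 p2 p3 :
  meeting d y p1 -> meeting d y p2 -> meeting d y p3 ->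
  cross d p1 < cross d p2 -> cross d p2 < cross d p3 ->
  exists s, [/\ 0 < s, s < 1 & p2 = p1 + s *: (p3 - p1)].
Proof.
move=> [e1 f1] [e2 f2] [e3 f3] l12 l23.
have d0 : d != 0.
  by apply: contraTneq l12 => ->; rewrite /cross !mxE !mul0r subrr ltxx.
have D : 0 < cross d p3 - cross d p1 by rewrite subr_gt0 (lt_trans l12).
pose s := (cross d p2 - cross d p1) / (cross d p3 - cross d p1).
have s0 : 0 < s by rewrite divr_gt0 // subr_gt0.
have s1 : s < 1 by rewrite ltr_pdivrMr // mul1r ltrD2r.
exists s; split => //.
have [t ht] : exists t, p1 + s *: (p3 - p1) - p2 = t *: d.
  by apply: cross_parallel => //; rewrite !crossE /s; field; rewrite gt_eqF.
have mE : p1 + s *: (p3 - p1) = p2 + t *: d by rewrite -ht; vec.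
have Km : K (p2 + t *: d).
  by rewrite -mE; apply: (convex_setP cK) (ltW s0) (ltW s1); [case: e1|case: e3].
have Kmy : K (p2 - y + t *: d).
  have -> : p2 - y + t *: d = p1 - y + s *: ((p3 - y) - (p1 - y)).
    by rewrite addrAC -mE; vec.
  by apply: (convex_setP cK) (ltW s0) (ltW s1); [case: f1|case: f3].
have [t0|t0|t0] := ltrgtP t 0.
- have := @enteringN _ _ cK _ _ (- t) e2; rewrite oppr_gt0 => /(_ t0).
  by rewrite scaleNr opprK.
- have := @enteringN _ _ cK _ _ t f2 t0.
  by rewrite scalerN opprK.
by rewrite mE t0 scale0r addr0.
Qed.

(** Distinct points of the meeting have distinct heights. Unless there are at most two, three of
    them are collinear, the middle one makes their line a supporting line by [supp_chord], and every
    further point lies on that line. *)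
Lemma few_faces_meeting d y : few_faces (meeting d y).
Proof.
have [->|d0] := eqVneq d 0.
  exists [::], [::]; split => // w [[_ nKw [s _]]].
  by rewrite scaler0 addr0.
have inj w w' : meeting d y w -> meeting d y w' -> cross d w = cross d w' -> w' = w.
  move=> [ew _] [ew' _] ww'.
  have [t ht] : exists t, w' - w = t *: d.
    by apply: cross_parallel => //; rewrite !crossE ww' subrr.
  have w'E : w' = w + t *: d by rewrite -ht addrC subrK.
  by move: ew'; rewrite w'E => /(entering_uniq cK ew) ->; rewrite scale0r addr0.
have [[p1 [p2 [p3 [c1 c2 c3 l12 l23]]]]|no3] := pselect (exists p1 p2 p3,
    [/\ meeting d y p1, meeting d y p2, meeting d y p3,
        cross d p1 < cross d p2 & cross d p2 < cross d p3]); last first.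
  have [[a ma]|na] := pselect (exists a, meeting d y a); last first.
    by exists [::], [::]; split => // w mw; case: na; exists w.
  have [[b [mb ab]]|nb] := pselect (exists b, meeting d y b /\ cross d a < cross d b).
    exists [:: a; b], [::]; split => // w mw; left; rewrite !inE.
    have [wa|aw|/(inj _ _ mw ma) ->] := ltrgtP (cross d w) (cross d a); last by rewrite eqxx.
      by case: no3; exists w, a, b.
    have [wb|bw|/(inj _ _ mw mb) ->] := ltrgtP (cross d w) (cross d b);
      last by rewrite eqxx orbT.
      by case: no3; exists a, w, b.
    by case: no3; exists a, b, w.
  have [[b [mb ba]]|nb'] := pselect (exists b, meeting d y b /\ cross d b < cross d a).
    exists [:: a; b], [::]; split => // w mw; left; rewrite !inE.
    have [wa|aw|/(inj _ _ mw ma) ->] := ltrgtP (cross d w) (cross d a); last by rewrite eqxx.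
      have [wb|bw|/(inj _ _ mw mb) ->] := ltrgtP (cross d w) (cross d b);
      last by rewrite eqxx orbT.
        by case: no3; exists w, b, a.
      by case: no3; exists b, w, a.
    by case: no3; exists b, a, w.
  exists [:: a], [::]; split => // w mw; left; rewrite !inE.
  have [wa|aw|/(inj _ _ mw ma) ->] := ltrgtP (cross d w) (cross d a); last by rewrite eqxx.
    by case: nb'; exists w.
  by case: nb; exists w.
have e0 : p3 - p1 != 0.
  by rewrite subr_eq0; apply: contraTneq (lt_trans l12 l23) => ->; rewrite ltxx.
exists [::], [:: p3 - p1; - (p3 - p1)]; split.
  by move=> e; rewrite !inE => /orP[]/eqP ->; rewrite ?oppr_eq0.
move=> w mw; right.
have [s [s0 s1 p2E]] := meeting_chord c1 c2 c3 l12 l23.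
have K1 : K p1 by case: c1 => -[].
have K3 : K p3 by case: c3 => -[].
have n2 : ~ K^° (p1 + s *: (p3 - p1)) by rewrite -p2E; case: c2 => -[].
have sup := supp_chord K1 K3 s0 s1 n2; rewrite -p2E in sup.
have ww : cross (p3 - p1) w = cross (p3 - p1) p2.
  have [l|l|/(inj _ _ mw c2) <-//] := ltrgtP (cross d w) (cross d p2).
    have [s' [s'0 s'1 p2E']] := meeting_chord mw c2 c3 l l23.
    apply/eqP; rewrite -subr_eq0; apply: contraTT s'1 => nz; rewrite -leNgt.
    suff -> : s' = 1 by [].
    have : (1 - s') * (cross (p3 - p1) (w - p2)) = 0.
      have h : (1 - s') *: (w - p2) = (- (s' * (1 - s))) *: (p3 - p1).
        have -> : - (s' * (1 - s)) *: (p3 - p1) = - s' *: (p3 - p2).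
          by rewrite p2E; vec.
        have -> : - s' *: (p3 - p2) = - s' *: (p3 - w) + - s' *: (w - p2) by vec.
        have -> : - s' *: (p3 - w) = w - p2 by rewrite p2E'; vec.
        by vec.
      by rewrite -crossZr h crossZr crossvv mulr0.
    move/eqP; rewrite mulf_eq0 crossDr crossNr (negbTE nz) orbF subr_eq0.
    by move/eqP.
  have [s' [s'0 s'1 p2E']] := meeting_chord c1 c2 mw l12 l.
  apply/eqP; rewrite -subr_eq0; apply: contraTT s'0 => nz; rewrite -leNgt.
  suff -> : s' = 0 by [].
  have : s' * (cross (p3 - p1) (w - p2)) = 0.
    have h : s' *: (w - p2) = (s * (1 - s')) *: (p3 - p1).
      transitivity ((1 - s') *: (s *: (p3 - p1))); last by vec.
      have -> : s *: (p3 - p1) = p2 - p1 by rewrite p2E; vec.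
      transitivity (s' *: (w - p1) - s' *: (p2 - p1)); first by vec.
      have -> : s' *: (w - p1) = p2 - p1 by rewrite {1}p2E'; vec.
      by vec.
    by rewrite -crossZr h crossZr crossvv mulr0.
  move/eqP; rewrite mulf_eq0 crossDr crossNr (negbTE nz) orbF.
  by move/eqP.
case: sup => sup; [exists (p3 - p1)|exists (- (p3 - p1))]; rewrite ?inE ?eqxx ?orbT //.
  by move=> z /sup; rewrite ww.
by move=> z /sup; rewrite !crossNl ww.
Qed.

Variables (X : plane R -> nat) (k : nat).
Hypothesis k_gt0 : (0 < k)%N.
Hypothesis tiling : is_kfold_translative_tiling k K X.
Let dX : discrete_multiset X := tiling.1.

Lemma tiling_nonempty : exists x, X x != 0%N.
Proof.
have [h _] := tiling_mass tiling 0.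
have [|x _ Xx] := (mass_gt0 dX (bounded_reach0 coK 0)).1 _; last by exists x.
exact: leq_trans h.
Qed.

(* Where a generic line leaves K + x0 it enters another translate K + x; three
   such points for the same x lie on a common edge. *)
Lemma boundary_few_faces : few_faces (K `\` K^°).
Proof.
have [x0 Xx0] := tiling_nonempty.
pose d : plane R := const_mx 1.
have d0 : d != 0 := const1_neq0 R.
have [m1 Km1 max1] := compact_argmax d coK Kn0.
have [m2 Km2 max2] := compact_argmax (- d) coK Kn0.
pose C := [set x | exists2 w, K w & K (x0 + w - x)].
have bC : bounded_set C.
  apply: bounded_subset (bounded_diff (bounded_sum (bounded_set1 x0)
    (compact_bounded coK)) (compact_bounded coK)) => x [w Kw Kx].
  exists (x0 + w), (x0 + w - x); split => //; last by rewrite subKr.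
  by exists x0, w.
have /finite_seqP[s sE] := dX bC.
have memC x : C x -> X x != 0%N -> x \in s.
  by move=> Cx Xx; have : [set` s] x by rewrite -sE.
(* Lines that touch a neighbouring translate at an extreme height are not generic; there are
   finitely many, and [lev] collects their entering points. *)
pose lev d' m x := [set w | entering K d' w /\ cross d' w = cross d' (x - x0 + m)].
pose F x := meeting d (x - x0) `|` meeting (- d) (x - x0) `|`
  (lev d m1 x `|` lev d m2 x) `|` (lev (- d) m1 x `|` lev (- d) m2 x).
have FF x : few_faces (F x).
  by do !apply: few_facesU; try exact: few_faces_level; exact: few_faces_meeting.
have ext : few_faces [set w | supp K d w \/ supp K (- d) w].
  exists [::], [:: d; - d]; split.
    by move=> e; rewrite !inE => /orP[]/eqP ->; rewrite ?oppr_eq0.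
  by move=> w [] sw; right; [exists d|exists (- d)]; rewrite // !inE eqxx ?orbT.
apply: few_facesS (few_facesU ext (few_faces_seq s FF)) => w [Kw nKw].
have [sw|/not_orP[ns1 ns2]] := pselect (supp K d w \/ supp K (- d) w); first by left.
right.
move/existsNP: ns1 => [b /not_implyP[Kb]] /negP; rewrite -ltNge => db.
move/existsNP: ns2 => [a /not_implyP[Ka]] /negP; rewrite -ltNge !crossNl ltrN2 => da.
have [r hr] := cross_level cK K0 Ka Kb da db.
have [[x [xs hx]]|nx] := pselect (exists x, x \in s /\
    (cross d w = cross d (x - x0 + m1) \/ cross d w = cross d (x - x0 + m2))).
  exists x => //; have [[_ ew]|[_ ew]] := boundary_entering Kw nKw hr.
    by left; right; case: hx => hx; [left|right].
  by right; case: hx => hx; [left|right]; split => //; rewrite !crossNl hx.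
have cr : crossing K X (x0 + w) d.
  apply: (level_crossing cK K0) => x Xx Kx; exists m2, m1.
  have xs : x \in s by apply: memC => //; exists w.
  split => //.
    have := max2 _ Kx; rewrite !crossNl lerN2 le_eqVlt => /orP[/eqP h|//].
    by case: nx; exists x; split => //; right; rewrite crossDr h -crossDr; congr cross; vec.
  have := max1 _ Kx; rewrite le_eqVlt => /orP[/eqP h|//].
  by case: nx; exists x; split => //; left; rewrite crossDr -h -crossDr; congr cross; vec.
have bal := tiling_balance coK cK dX tiling cr.
have bnd d' : bounded_set [set x | entering K d' (x0 + w - x)].
  by apply: bounded_subset (bounded_reach0 coK (x0 + w)) => x [].
have opp d' : entering K d' w -> in_count K X (x0 + w) d' = in_count K X (x0 + w) (- d') ->
    exists2 x, x \in s & meeting d' (x - x0) w.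
  move=> ew bal'.
  have : (0 < in_count K X (x0 + w) d')%N.
    apply/(mass_gt0 dX (bnd d')); exists x0; last exact: Xx0.
    by rewrite /= [x0 + w - x0]addrAC subrr add0r.
  rewrite bal'.
  move=> /(mass_gt0 dX (bnd _))[x ex Xx]; exists x.
    by apply: memC Xx; exists w; [exact: Kw|case: ex].
  split; first exact: ew.
  have wE : w - (x - x0) = x0 + w - x by vec.
  by rewrite wE; exact: ex.
have [[_ ew]|[_ ew]] := boundary_entering Kw nKw hr.
  have [x xs mx] := opp d ew bal.
  by exists x; [exact: xs|left; left; left; exact: mx].
have [|x xs mx] := opp (- d) ew; first by rewrite opprK; exact/esym.
by exists x; [exact: xs|left; left; right; exact: mx].
Qed.

(* An edge datum (e, (q, r)) stands for the pair of opposite edges [q, q + e], [r, r + e]. *)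
Definition edge (E : plane R * (plane R * plane R)) :=
  [/\ E.1 != 0,
   forall z, K z /\ supp K E.1 z <-> exists t, [/\ 0 <= t, t <= 1 & z = E.2.1 + t *: E.1] &
   forall z, K z /\ supp K (- E.1) z <-> exists t, [/\ 0 <= t, t <= 1 & z = E.2.2 + t *: E.1]].

Definition on_edge (E : plane R * (plane R * plane R)) z :=
  K z /\ (supp K E.1 z \/ supp K (- E.1) z).

Lemma suppZ e (s : R) z : 0 < s -> supp K (s *: e) z <-> supp K e z.
Proof.
by move=> s0; split=> h y /h; rewrite !crossZl ler_pM2l.
Qed.

(** The two faces have lengths [l] and [m] in units of [e], possibly 0. [unequal_windows], used in
    both directions, excludes [l < m] and [m < l]; in particular an edge cannot face a vertex. The
    edge vector is [e] rescaled by the common length. *)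
Lemma parallel_faces e : e != 0 ->
  (exists q r, forall z, K z -> supp K e z \/ supp K (- e) z -> z \in [:: q; r]) \/
  (exists E, [/\ edge E, balanced X E.1 (E.2.1 - E.2.2) &
    forall z, K z -> supp K e z \/ supp K (- e) z -> on_edge E z]).
Proof.
move=> e0; have [q [l [l0 sq top]]] := face_segment cK coK e0 Kn0.
have Ne0 : - e != 0 by rewrite oppr_eq0.
have [r' [m [m0 sr bot']]] := face_segment cK coK Ne0 Kn0.
pose r := r' - m *: e.
have bot z : K z /\ supp K (- e) z <-> exists t, [/\ 0 <= t, t <= m & z = r + t *: e].
  by rewrite bot'; split=> -[t [t0 tm ->]]; exists (m - t); split;
    [lra|lra|rewrite /r; vec|lra|lra|rewrite /r; vec].
have FB := face_balance coK cK K0 dX tiling e0 l0 m0 top bot.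
have lm : l = m.
  have [x Xx] := tiling_nonempty.
  have [lm|ml|//] := ltrgtP l m.
    have [M hM] := window_bound coK K0 dX tiling e0 l0.
    have := unequal_windows dX e0 l0 lm hM (c := r - q).
    move=> /(_ _ x) X0; move: Xx; rewrite X0 // => p.
    by rewrite (FB (p + (r - q))); congr (mass X (seg _ e 0 m)); vec.
  have [M hM] := window_bound coK K0 dX tiling e0 m0.
  by have := unequal_windows dX e0 m0 ml hM FB x; move/eqP; rewrite (negbTE Xx).
have [l00|ln0] := eqVneq l 0.
  left; exists q, r => z Kz; rewrite !inE; case=> sz.
    have [t [t0 tl ->]] := (top z).1 (conj Kz sz).
    by have -> : t = 0; [lra|rewrite scale0r addr0 eqxx].
  have [t [t0 tl ->]] := (bot z).1 (conj Kz sz).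
  by have -> : t = 0; [lra|rewrite scale0r addr0 eqxx orbT].
have lp : 0 < l by rewrite lt_neqAle eq_sym ln0.
have resc (q0 z : plane R) : (exists t, [/\ 0 <= t, t <= 1 & z = q0 + t *: (l *: e)]) <->
    (exists t, [/\ 0 <= t, t <= l & z = q0 + t *: e]).
  split=> -[t [t0 t1 ->]].
    exists (t * l); rewrite scalerA; split => //; first by rewrite mulr_ge0.
    by rewrite -[leRHS]mul1r ler_pM2r.
  exists (t / l); rewrite scalerA mulfVK //; split => //; first by rewrite divr_ge0.
  by rewrite ler_pdivrMr // mul1r.
right; exists (l *: e, (q, r)); split => /=.
- split => /= [|z|z]; first by rewrite scaler_eq0 negb_or ln0.
    by rewrite suppZ // top resc.
  by rewrite -scalerN suppZ // bot -lm resc.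
- move=> p; have segE p' : seg p' (l *: e) 0 1 = seg p' e 0 l.
    apply/seteqP; split=> x [t [t0 t1 ->]].
      exists (t * l); rewrite scalerA; split => //; first by rewrite mulr_ge0.
      by rewrite -[ltRHS]mul1r ltr_pM2r.
    exists (t / l); rewrite scalerA mulfVK //; split => //; first by rewrite divr_ge0.
    by rewrite ltr_pdivrMr // mul1r.
  by rewrite !segE FB lm.
by move=> z Kz sz; split => //=; rewrite -scalerN !suppZ.
Qed.

Lemma tile_edges : exists (V : seq (plane R)) (Es : seq (plane R * (plane R * plane R))),
  (forall E, E \in Es -> edge E /\ balanced X E.1 (E.2.1 - E.2.2)) /\
  (forall w, K w -> ~ K^° w -> w \in V \/ exists2 E, E \in Es & on_edge E w).
Proof.
have [V [ds [ds0 hV]]] := boundary_few_faces.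
suff [V' [Es [h1 h2]]] : exists (V' : seq (plane R)) (Es : seq (plane R * (plane R * plane R))),
  (forall E, E \in Es -> edge E /\ balanced X E.1 (E.2.1 - E.2.2)) /\
  (forall w e, e \in ds -> K w -> supp K e w -> w \in V' \/ exists2 E, E \in Es & on_edge E w).
  exists (V ++ V'), Es; split => // w Kw nKw; rewrite mem_cat.
  have [->|[e eds se]] := hV w (conj Kw nKw); first by left.
  by have [->|?] := h2 w e eds Kw se; [left; rewrite orbT|right].
elim: ds ds0 {hV} => [|e ds ih] ds0; first by exists [::], [::].
have [|V' [Es [h1 h2]]] := ih; first by move=> e' e'ds; apply: ds0; rewrite inE e'ds orbT.
have e0 : e != 0 by apply: ds0; rewrite inE eqxx.
have [[q [r qr]]|[E [hE bE onE]]] := parallel_faces e0.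
  exists (q :: r :: V'), Es; split => // w e'; rewrite inE => /orP[/eqP ->|e'ds] Kw sw.
    by left; have := qr w Kw (or_introl sw); rewrite !inE orbA => ->.
  by have [wV|?] := h2 w e' e'ds Kw sw; [left; rewrite !inE wV !orbT|right].
exists V', (E :: Es); split=> [E'|w e']; first by rewrite inE => /orP[/eqP ->|/h1].
rewrite inE => /orP[/eqP ->|e'ds] Kw sw.
  by right; exists E; [rewrite inE eqxx|exact: onE (or_introl sw)].
have [wV|[E' E'Es on']] := h2 w e' e'ds Kw sw; first by left.
by right; exists E' => //; rewrite inE E'Es orbT.
Qed.

End Polygon.

(** * Periods *)

Section Periods.
Variable R : realType.
Implicit Types (c d e g p q u v w x : plane R) (Y : plane R -> int).

Definition periodic Y v := forall p, Y (p + v) = Y p.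

Lemma periodicZ Y v (a : int) : periodic Y v -> periodic Y (a%:~R *: v).
Proof.
move=> Yv; have nat_case (n : nat) p : Y (p + n%:R *: v) = Y p.
  elim: n p => [|n ih] p; first by rewrite scale0r addr0.
  by rewrite -natr1 scalerDl scale1r addrA Yv ih.
case: a => n p; first by rewrite -pmulrn nat_case.
rewrite NegzE mulrNz scaleNr -pmulrn.
by rewrite -(nat_case n.+1 (p - _)) subrK.
Qed.

Lemma periodicD Y u v : periodic Y u -> periodic Y v -> periodic Y (u + v).
Proof. by move=> Yu Yv p; rewrite addrA Yv Yu. Qed.

(** The equation [(1 - T_e)(1 - T_c) Y = 0] in the shape of [balanced_periodic], over [int] because
    differences of [Y] will be taken. *)
Definition mixed_periodic Y e c := forall p, Y p + Y (p + c - e) = Y (p + c) + Y (p - e).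

(* Replacing Y by its c-difference whenever that difference is nonzero yields a
   period e, and otherwise c is a period already. *)
Lemma exists_periods (Ps : seq (plane R * plane R)) Y :
  (exists p, Y p != 0) -> (forall P, P \in Ps -> mixed_periodic Y P.1 P.2) ->
  exists Y' (Q : seq (plane R)),
  [/\ exists p, Y' p != 0,
      forall p, Y' p != 0 -> exists2 q, q \in Q & Y (p + q) != 0,
      forall v, periodic Y v -> periodic Y' v &
      forall P, P \in Ps -> periodic Y' P.1 \/ periodic Y' P.2].
Proof.
elim: Ps Y => [|[e c] Ps ih] Y Y0 mix.
  by exists Y, [:: 0]; split => // p Yp; exists 0; rewrite ?inE ?eqxx ?addr0.
have mixPs P : P \in Ps -> mixed_periodic Y P.1 P.2.
  by move=> PPs; apply: mix; rewrite inE PPs orbT.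
have [Yc|nYc] := pselect (periodic Y c).
  have [Y' [Q [h1 h2 h3 h4]]] := ih Y Y0 mixPs; exists Y', Q; split => // P.
  by rewrite inE => /orP[/eqP ->|/h4//]; right; exact: h3.
pose Z p := Y (p + c) - Y p.
have Z0 : exists p, Z p != 0.
  by have /existsNP[p /eqP hp] := nYc; exists p; rewrite subr_eq0.
have mixZ P : P \in Ps -> mixed_periodic Z P.1 P.2.
  move=> /mixPs m p; have := m p; have := m (p + c); rewrite /Z.
  rewrite (addrAC p c P.2) (addrAC _ c (- P.1)) (addrAC p c (- P.1)).
  by move=> h1 h2; rewrite addrACA -opprD h1 h2 opprD addrACA.
have [Y' [Q [h1 h2 h3 h4]]] := ih Z Z0 mixZ.
(* A nonzero difference [Z p] has [Y p] or [Y (p + c)] nonzero, so each shift in [Q] splits in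
   two. *)
exists Y', ([seq q + c | q <- Q] ++ Q); split => //.
- move=> p /h2[q qQ]; rewrite /Z.
  have [->|Yq] := eqVneq (Y (p + q)) 0; last by exists q; rewrite ?mem_cat ?qQ ?orbT.
  rewrite subr0 -addrA => Yqc; exists (q + c); last exact: Yqc.
  by rewrite mem_cat (map_f (fun q => q + c) qQ).
- move=> v Yv; apply: h3 => p; rewrite /Z Yv; congr (_ - _).
  by rewrite addrAC Yv.
move=> P; rewrite inE => /orP[/eqP ->|/h4//]; left; apply: h3 => p /=.
have := mix (e, c); rewrite inE eqxx => /(_ isT (p + e)) /=.
rewrite addrK (addrAC _ c (- e)) addrK => h.
by rewrite /Z; move: (Y (p + e)) (Y (p + c)) (Y (p + e + c)) (Y p) h => y1 y2 y3 y4; lia.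
Qed.

Lemma fractional_part (r : R) : 0 <= r - (Num.floor r)%:~R < 1.
Proof. by have := floor_itv r; rewrite intrD => /andP[h1 h2]; lra. Qed.

(** The multiples of [w], reduced modulo [Z g1 + Z g2], stay bounded, so the witnesses [x] range
    over a finite part of [X] and [f] takes finitely many values on the reduced multiples. With
    [f = id] a coincidence makes [w] rational over [g1], [g2]; with [f = cross e] it does so modulo
    [R e]. *)
Lemma recurrence (X : plane R -> nat) (T : eqType) (f : plane R -> T)
    g1 g2 w (Q : seq (plane R)) (C : set (plane R)) :
  discrete_multiset X -> cross g1 g2 != 0 -> bounded_set C ->
  (forall (n : nat) (a b : int), let d := n%:R *: w + (a%:~R *: g1 + b%:~R *: g2) in
    exists2 q, q \in Q & exists x, [/\ X x != 0%N, C (x - d) & f d = f (x - q)]) ->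
  exists d d', f d = f d' /\ exists (n : nat) (a b : int), (0 < n)%N /\
    d' - d = n%:R *: w + (a%:~R *: g1 + b%:~R *: g2).
Proof.
move=> dX g12 bC h.
have [al [be wE]] : exists al be : R, w = al *: g1 + be *: g2.
  by do 2 eexists; exact: cross_basis.
pose d (n : nat) := n%:R *: w +
  ((- Num.floor (n%:R * al))%:~R *: g1 + (- Num.floor (n%:R * be))%:~R *: g2).
have dE n : d n = (n%:R * al - (Num.floor (n%:R * al))%:~R) *: g1
                + (n%:R * be - (Num.floor (n%:R * be))%:~R) *: g2.
  by rewrite /d {1}wE !mulrNz; vec.
pose B := [set x | exists n, x = d n].
have bB : bounded_set B.
  apply: bounded_subset (bounded_sum (bounded_scale g1 1) (bounded_scale g2 1)).
  move=> _ [n ->]; rewrite dE; do 2 eexists; split; last by [].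
    by eexists; last by []; rewrite /=; have := fractional_part (n%:R * al);
      move=> /andP[h0 h1]; rewrite ger0_norm // ltW.
  by eexists; last by []; rewrite /=; have := fractional_part (n%:R * be);
    move=> /andP[h0 h1]; rewrite ger0_norm // ltW.
have /finite_seqP[s sE] := dX _ (bounded_sum bC bB).
pose vals := [seq f (xq.1 - xq.2) | xq <- [seq (x, q) | x <- s, q <- Q]].
have fd n : f (d n) \in vals.
  have [q qQ [x [Xx Cx ->]]] := h n (- Num.floor (n%:R * al)) (- Num.floor (n%:R * be)).
  apply/mapP; exists (x, q) => //; apply/allpairsP; exists (x, q); split => //=.
  have : [set` s] x by rewrite -sE; split => //; exists (x - d n), (d n);
    split; [|exists n|rewrite subrK].
  by [].
pose L := [seq f (d n) | n <- iota 0 (size vals).+1].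
have /(uniqPn (f 0))[i [j [ij]]] : ~~ uniq L.
  have sub : {subset L <= vals} by move=> y /mapP[n _ ->].
  by apply/negP => /uniq_leq_size/(_ sub); rewrite size_map size_iota ltnn.
rewrite size_map size_iota => jl.
have il := ltn_trans ij jl.
rewrite !(nth_map 0%N) ?size_iota // !nth_iota // !add0n => fij.
exists (d i), (d j); split => //.
exists (j - i)%N, (- Num.floor (j%:R * al) + Num.floor (i%:R * al)),
  (- Num.floor (j%:R * be) + Num.floor (i%:R * be)); split; first by rewrite subn_gt0.
rewrite /d natrB 1?ltnW // !intrD !mulrNz.
vec.
Qed.

Definition frac_lattice g1 g2 (N : nat) := [set x | exists a b : int,
  N%:R *: x = a%:~R *: g1 + b%:~R *: g2].

(** Two ways for the lattice to be balanced: [c] is a period and carries one window to the other, or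
    [e] is a period, windows may slide along [e], and only [c] modulo [R e] matters. *)
Definition lattice_edge g1 g2 N e c := frac_lattice g1 g2 N c \/
  frac_lattice g1 g2 N e /\ exists s : R, frac_lattice g1 g2 N (c - s *: e).

Lemma frac_latticeM g1 g2 N M x : frac_lattice g1 g2 N x -> frac_lattice g1 g2 (N * M) x.
Proof.
move=> [a [b h]]; exists (M%:Z * a), (M%:Z * b).
by rewrite mulnC natrM -scalerA h !intrM -!pmulrn; vec.
Qed.

Lemma lattice_edgeM g1 g2 N M e c :
  lattice_edge g1 g2 N e c -> lattice_edge g1 g2 (N * M) e c.
Proof.
case=> [h|[h [s hs]]]; first by left; exact: frac_latticeM.
by right; split; [|exists s]; exact: frac_latticeM.
Qed.

Lemma lattice_edge_seq g1 g2 (Ps : seq (plane R * plane R)) :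
  (forall P, P \in Ps -> exists2 N, (0 < N)%N & lattice_edge g1 g2 N P.1 P.2) ->
  exists2 N, (0 < N)%N & forall P, P \in Ps -> lattice_edge g1 g2 N P.1 P.2.
Proof.
elim: Ps => [|P Ps ih] h; first by exists 1%N.
have [|N N0 hN] := ih; first by move=> P' P'Ps; apply: h; rewrite inE P'Ps orbT.
have [|M M0 hM] := h P; first by rewrite inE eqxx.
exists (N * M)%N; first by rewrite muln_gt0 N0.
move=> P'; rewrite inE => /orP[/eqP ->|/hN]; last exact: lattice_edgeM.
by rewrite mulnC; exact: lattice_edgeM.
Qed.

Lemma balanced_iter (X : plane R -> nat) e c p (n : nat) : balanced X e c ->
  mass X (seg (p + n%:R *: c) e 0 1) = mass X (seg p e 0 1).
Proof.
move=> bal; elim: n => [|n ih]; first by rewrite scale0r addr0.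
by rewrite -natr1 scalerDl scale1r addrA -bal ih.
Qed.

Lemma common_lattice (X : plane R -> nat) (Ps : seq (plane R * plane R)) P1 P2 P3 :
  discrete_multiset X -> (exists x, X x != 0%N) ->
  (forall P, P \in Ps -> P.1 != 0 /\ balanced X P.1 P.2) ->
  P1 \in Ps -> P2 \in Ps -> P3 \in Ps ->
  cross P1.1 P2.1 != 0 -> cross P1.1 P3.1 != 0 -> cross P2.1 P3.1 != 0 ->
  cross P1.2 P2.2 != 0 -> cross P1.2 P3.2 != 0 -> cross P2.2 P3.2 != 0 ->
  exists g1 g2, cross g1 g2 != 0 /\
  exists2 N, (0 < N)%N & forall P, P \in Ps -> lattice_edge g1 g2 N P.1 P.2.
Proof.
move=> dX X0 hPs h1 h2 h3 e12 e13 e23 c12 c13 c23.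
pose Y0 p := (X p)%:Z.
have Y00 : exists p, Y0 p != 0 by have [x Xx] := X0; exists x; exact: Xx.
have mix P : P \in Ps -> mixed_periodic Y0 P.1 P.2.
  move=> /hPs[e0 bal] p; rewrite /Y0 -!PoszD.
  by congr Posz; exact: balanced_periodic.
have [Y [Q [[p0 Yp0] YX _ per]]] := exists_periods Y00 mix.
have [g1 [g2 [g12 per1 per2]]] : exists g1 g2,
    [/\ cross g1 g2 != 0, periodic Y g1 & periodic Y g2].
  (* Two of the three edges have periods of the same kind; this is why both the [e] and the [c] are
     assumed pairwise independent. *)
  have [p1|p1] := per _ h1; have [p2|p2] := per _ h2; have [p3|p3] := per _ h3;
    by [exists P1.1, P2.1|exists P1.2, P2.2|exists P1.1, P3.1|exists P1.2, P3.2
       |exists P2.1, P3.1|exists P2.2, P3.2].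
exists g1, g2; split => //; apply: lattice_edge_seq => P PPs.
have perl (a b : int) : periodic Y (a%:~R *: g1 + b%:~R *: g2).
  by apply: periodicD; exact: periodicZ.
have [e0 bal] := hPs P PPs.
pose Q' := [seq p0 + q | q <- Q].
have X0' v : periodic Y v -> exists2 q, q \in Q & X (p0 + v + q) != 0%N.
  by move=> Yv; have [|q qQ Yq] := YX (p0 + v); [rewrite Yv|exists q; [|exact: Yq]].
have rational v : periodic Y v -> exists2 N, (0 < N)%N & frac_lattice g1 g2 N v.
  move=> Yv; pose C := [set` Q'].
  have bC : bounded_set C.
    apply/bounded_setE; exists (\sum_(q <- Q') `|q|) => x xQ.
    by rewrite (big_rem x) //= lerDl sumr_ge0.
  have [|d [d' [dd [n [a [b [n0 h]]]]]]] := @recurrence X _ id g1 g2 v Q' C dX g12 bC.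
    move=> n a b d.
    have perd : periodic Y d by apply: periodicD => //; exact: (periodicZ n Yv).
    have [q qQ Xq] := X0' d perd; exists (p0 + q); first exact: map_f.
    exists (p0 + d + q); split => //; last by vec.
    by rewrite (_ : _ - _ = p0 + q); [exact: map_f|vec].
  exists n => //; exists (- a), (- b); move: h; rewrite dd subrr => h.
  rewrite !mulrNz !scaleNr -opprD; apply/eqP; rewrite -subr_eq0 opprK -h; exact/eqP.
case: (per P PPs) => [perE|perC]; last first.
  by have [N N0 hN] := rational _ perC; exists N => //; left.
have [N N0 hN] := rational _ perE.
(* The period [e] of [Y] says nothing about [c], so [X] itself is used: a window at a point of [X]
   keeps its positive mass under shifts by [c], and the point found there is known up to its
   position along [e]. *)
pose C := [set x | exists2 q, q \in Q' & seg q P.1 0 1 x].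
have bC : bounded_set C.
  apply: (@bounded_subset _ _ [set x | exists a b, [/\ [set` Q'] a,
    [set t *: P.1 | t in [set t : R | `|t| <= 1]] b & x = a - b]]).
    move=> x [q qQ [t [t0 t1 ->]]]; exists q, (t *: P.1); split => //.
    by exists t => //=; rewrite ger0_norm // ltW.
  apply: bounded_diff (bounded_scale _ _).
  apply/bounded_setE; exists (\sum_(q <- Q') `|q|) => x xQ.
  by rewrite (big_rem x) //= lerDl sumr_ge0.
have [|d [d' [dd [n [a [b [n0 h]]]]]]] :=
    @recurrence X _ (cross P.1) g1 g2 P.2 Q' C dX g12 bC.
  move=> n a b; set v := _ + (b%:~R *: g2); move=> d.
  have [q qQ Xq] := X0' v (perl a b).
  have : (0 < mass X (seg (p0 + v + q) P.1 0%R 1%R))%N.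
    apply/(mass_gt0 dX (bounded_seg _ _ _ _)); exists (p0 + v + q) => //.
    by exists 0; rewrite scale0r subr0 lexx ltr01.
  rewrite -(balanced_iter _ n bal) => /(mass_gt0 dX (bounded_seg _ _ _ _))[x xs Xx].
  exists (p0 + q); first exact: map_f.
  case: xs => t [t0 t1 xE]; exists x; split => //.
    exists (p0 + q); first exact: map_f.
    by exists t; split => //; rewrite xE /d; vec.
  by rewrite xE /d !crossE; ring.
exists (N * n)%N; first by rewrite muln_gt0 N0.
right; split; first exact: frac_latticeM.
have [s hs] : exists s, n%:R *: P.2 + (a%:~R *: g1 + b%:~R *: g2) = s *: P.1.
  by apply: cross_parallel => //; rewrite -h crossDr crossNr dd subrr.
exists (s / n%:R); rewrite mulnC; apply: frac_latticeM.
exists (- a), (- b).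
have n0' : n%:R != 0 :> R by rewrite pnatr_eq0 -lt0n.
rewrite scalerBr scalerA mulrCA divff // mulr1 -hs !mulrNz; vec.
Qed.

End Periods.

(** * Balanced multisets tile *)

Lemma locally_constant01 (R : realType) (T : Type) (v : R -> T) :
  (forall t, 0 <= t -> t <= 1 -> exists2 e, 0 < e &
     forall s, 0 <= s -> s <= 1 -> `|s - t| < e -> v s = v t) ->
  v 0 = v 1.
Proof.
move=> lc.
pose A := [set t : R | [/\ 0 <= t, t <= 1 & forall s, 0 <= s -> s <= t -> v s = v 0]].
have A0 : A 0.
  by split => // s s0 s1; congr v; apply/eqP; rewrite eq_le s0 s1.
have ubA : ubound A 1 by move=> t [].
have supA : has_sup A by split; [exists 0|exists 1].
pose m := sup A.
have m0 : 0 <= m by apply: sup_upper_bound.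
have m1 : m <= 1 by apply: ge_sup => //; exists 0.
have [e e0 he] := lc m m0 m1.
have [t [t0 t1 ht] tm] := sup_adherent e0 supA.
have tlem : t <= m by apply: sup_upper_bound.
have vtm : v t = v m by apply: he => //; rewrite ltr_norml; move: tm; rewrite -/m; lra.
have vm : v m = v 0 by rewrite -vtm; exact: ht.
have upto s : 0 <= s -> s <= 1 -> s < m + e -> v s = v 0.
  move=> s0 s1 sm; have [st|ts] := lerP s t; first exact: ht.
  rewrite -vm; apply: he => //; rewrite ltr_norml; move: tm; rewrite -/m; lra.
have [ml1|m1'] := ltrP m 1; last by rewrite upto //; lra.
pose m' := Num.min 1 (m + e / 2).
have e2 : 0 < e / 2 by rewrite divr_gt0.
have e2' : e / 2 < e by rewrite ltr_pdivrMr // ltr_pMr // ltr1n.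
have m'1 : m' <= 1 by rewrite ge_min lexx.
have m'2 : m' <= m + e / 2 by rewrite ge_min lexx orbT.
have mm' : m < m' by rewrite lt_min ml1 /=; lra.
have : m' <= m.
  apply: sup_upper_bound => //; split => //; first by lra.
  by move=> s s0 sm'; apply: upto; lra.
by rewrite leNgt mm'.
Qed.

Section BalancedTiling.
Variables (R : realType) (K : set (plane R)) (X : plane R -> nat).
Implicit Types (a b d e p q r u v w x y z : plane R).
Implicit Types E : plane R * (plane R * plane R).
Hypotheses (coK : compact K) (cK : convex_set K) (K0 : K^° !=set0).
Hypothesis dX : discrete_multiset X.
Variables (V : seq (plane R)) (Es : seq (plane R * (plane R * plane R))).
Hypothesis edgeEs : forall E, E \in Es -> edge K E.
Hypothesis balEs : forall E, E \in Es -> balanced X E.1 (E.2.1 - E.2.2).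
Hypothesis bdK : forall w, K w -> ~ K^° w -> w \in V \/ exists2 E, E \in Es & on_edge K E w.

(** The boundaries of translates through [z] all run along one line near [z]: no edge ends at [z],
    and no two nonparallel edges cross there. *)
Definition generic z := forall x, X x != 0%N -> K (z - x) ->
  z - x \notin V /\
  forall E, E \in Es ->
    [/\ z - x != E.2.1, z - x != E.2.1 + E.1, z - x != E.2.2, z - x != E.2.2 + E.1 &
     on_edge K E (z - x) -> forall x' E', X x' != 0%N -> E' \in Es ->
       on_edge K E' (z - x') -> cross E.1 E'.1 = 0].

Lemma cross_par0 e e' w : e != 0 -> e' != 0 -> cross e e' = 0 ->
  supp K e' w \/ supp K (- e') w -> supp K e w \/ supp K (- e) w.
Proof.
move=> e0 e'0 ee'; have [t e'E] := cross_parallel e0 ee'.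
have t0 : t != 0 by apply: contraNneq e'0 => t0; rewrite e'E t0 scale0r.
have [tn|tp|/eqP] := ltrgtP t 0; last by rewrite (negbTE t0).
  have tp : 0 < - t by rewrite oppr_gt0.
  have -> : e' = (- t) *: - e by rewrite e'E scaleNr scalerN opprK.
  by rewrite -scalerN opprK !suppZ //; case; [right|left].
by rewrite e'E -scalerN !suppZ.
Qed.

Lemma edge_face_crossing z x d e q :
  (forall t, 0 <= t -> t <= 1 -> K (q + t *: e)) -> cross e d != 0 ->
  (exists t, [/\ 0 <= t, t <= 1 & z - x = q + t *: e]) ->
  z - x != q -> z - x != q + e -> exists s, K^° (z - x + s *: d).
Proof.
move=> Kq ed [t [t0 t1 zE]] zq zqe.
have Kq0 : K q by rewrite -[q]addr0 -(scale0r e); exact: Kq.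
have Kq1 : K (q + e) by rewrite -(scale1r e); exact: Kq.
have t0' : 0 < t.
  rewrite lt_neqAle t0 andbT; apply: contraNneq zq => t00.
  by rewrite zE -t00 scale0r addr0.
have t1' : t < 1.
  rewrite lt_neqAle t1 andbT; apply: contraNneq zqe => t11.
  by rewrite zE t11 scale1r.
have de : cross d e != 0 by rewrite crossC oppr_eq0.
have cE : cross d (z - x) = cross d q + t * cross d e by rewrite zE crossDr crossZr.
have qE : cross d (q + e) = cross d q + cross d e by rewrite crossDr.
have [n|p|/eqP] := ltrgtP (cross d e) 0; last by rewrite (negbTE de).
  apply: (cross_level cK K0 Kq1 Kq0); rewrite cE ?qE; first by nra.
  by rewrite gtrDl; nra.
apply: (cross_level cK K0 Kq0 Kq1); rewrite cE ?qE; last by nra.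
by rewrite ltrDl; nra.
Qed.

Lemma edge_sub E t : E \in Es -> 0 <= t -> t <= 1 ->
  K (E.2.1 + t *: E.1) /\ K (E.2.2 + t *: E.1).
Proof.
move=> /edgeEs[_ top bot] t0 t1; split.
  by have [] := (top (E.2.1 + t *: E.1)).2 (ex_intro _ t (And3 t0 t1 erefl)).
by have [] := (bot (E.2.2 + t *: E.1)).2 (ex_intro _ t (And3 t0 t1 erefl)).
Qed.

Lemma generic_crossing z d : generic z -> (forall E, E \in Es -> cross E.1 d != 0) ->
  crossing K X z d.
Proof.
move=> gz Ed x Xx Kx; have [ix|nix] := pselect (K^° (z - x)).
  by exists 0; rewrite scale0r addr0.
have [nV gE] := gz x Xx Kx.
have [xV|[E EEs [_ sE]]] := bdK Kx nix; first by case/negP: nV; exact: xV.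
have [e0 top bot] := edgeEs EEs; have [n1 n2 n3 n4 _] := gE E EEs.
case: sE => sE.
  apply: (edge_face_crossing _ (Ed E EEs) ((top _).1 (conj Kx sE)) n1 n2).
  by move=> t t0 t1; case: (edge_sub EEs t0 t1).
apply: (edge_face_crossing _ (Ed E EEs) ((bot _).1 (conj Kx sE)) n3 n4).
by move=> t t0 t1; case: (edge_sub EEs t0 t1).
Qed.

(** With [cross E.1 d < 0], [d] points inwards at the top edge and outwards at the bottom one.
    Half-open windows do no harm, as [z] is never at the end of an edge. *)
Lemma edge_in_count z d E : generic z -> (forall E, E \in Es -> cross E.1 d != 0) ->
  E \in Es -> cross E.1 d < 0 ->
  (forall x, X x != 0%N -> K (z - x) -> ~ K^° (z - x) -> on_edge K E (z - x)) ->
  in_count K X z d = mass X (seg (z - E.2.1) E.1 0 1) /\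
  in_count K X z (- d) = mass X (seg (z - E.2.2) E.1 0 1).
Proof.
move=> gz Ed EEs ed onE; have [e0 top bot] := edgeEs EEs.
have Ne0 : - E.1 != 0 by rewrite oppr_eq0.
have cr := generic_crossing gz Ed.
have segE q x : seg (z - q) E.1 0 1 x <-> exists t, [/\ 0 <= t, t < 1 & z - x = q + t *: E.1].
  split=> [[t [t0 t1 ->]]|[t [t0 t1 h]]]; exists t; split => //; first by vec.
  by transitivity (z - (z - x)); [vec|rewrite h; vec].
have half q x : z - x != q + E.1 ->
    (exists t, [/\ 0 <= t, t <= 1 & z - x = q + t *: E.1]) ->
    (exists t, [/\ 0 <= t, t < 1 & z - x = q + t *: E.1]).
  move=> n [t [t0 t1 h]]; exists t; split => //; rewrite lt_neqAle t1 andbT.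
  by apply: contraNneq n => t11; rewrite h t11 scale1r.
have closed q x : (exists t, [/\ 0 <= t, t < 1 & z - x = q + t *: E.1]) ->
    (exists t, [/\ 0 <= t, t <= 1 & z - x = q + t *: E.1]).
  by move=> [t [t0 t1 h]]; exists t; split => //; exact: ltW.
split; apply: mass_ext => x Xx; rewrite segE; split.
- move=> [Kx nKx [s s0 Ks]]; have [_ [sE|sE]] := onE x Xx Kx nKx.
    have [_ /(_ E EEs)[_ n2 _ _ _]] := gz x Xx Kx.
    by apply: (half _ _ n2); apply/top; exact: (conj Kx sE).
  have := supp_interior Ne0 sE Ks; rewrite crossDr crossZr gtrDl !crossNl.
  by rewrite (pmulr_rlt0 _ s0) oppr_lt0 => /(lt_trans ed); rewrite ltxx.
- move=> /closed/top[Kx sE]; split; first exact: Kx.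
    by move=> /(supp_interior e0 sE); rewrite ltxx.
  have [s Ks] := cr x Xx Kx; exists s; last exact: Ks.
  have := supp_interior e0 sE Ks; rewrite crossDr crossZr gtrDl.
  by rewrite nmulr_llt0.
- move=> [Kx nKx [s s0 Ks]]; have [_ [sE|sE]] := onE x Xx Kx nKx.
    have := supp_interior e0 sE Ks; rewrite crossDr crossZr gtrDl crossNr.
    by rewrite (pmulr_rlt0 _ s0) oppr_lt0 => /(lt_trans ed); rewrite ltxx.
  have [_ /(_ E EEs)[_ _ _ n4 _]] := gz x Xx Kx.
  by apply: (half _ _ n4); apply/bot; exact: (conj Kx sE).
move=> /closed/bot[Kx sE]; split; first exact: Kx.
  by move=> /(supp_interior Ne0 sE); rewrite ltxx.
have [s Ks] := cr x Xx Kx; exists (- s).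
  have := supp_interior Ne0 sE Ks; rewrite crossDr crossZr gtrDl crossNl.
  by rewrite oppr_gt0 pmulr_llt0 // oppr_gt0.
by rewrite scalerN scaleNr opprK.
Qed.

(** All boundaries through [z] are parallel to a single edge [E], so the balance of [E] alone
    decides; the opposite sign of [cross E.1 d] exchanges the two counts. *)
Lemma generic_balance z d : generic z -> (forall E, E \in Es -> cross E.1 d != 0) ->
  in_count K X z d = in_count K X z (- d).
Proof.
move=> gz Ed.
have [[x0 [Xx0 Kx0 nKx0]]|nb] := pselect (exists x,
    [/\ X x != 0%N, K (z - x) & ~ K^° (z - x)]);
  last first.
  have no d' : in_count K X z d' = 0%N.
    by apply: mass_set0 => x Xx [Kx nKx _]; apply: nb; exists x; exact: And3.
  by rewrite !no.
have [nV gE] := gz x0 Xx0 Kx0.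
have [xV|[E EEs onE0]] := bdK Kx0 nKx0; first by case/negP: nV; exact: xV.
have [e0 _ _] := edgeEs EEs.
have onE x : X x != 0%N -> K (z - x) -> ~ K^° (z - x) -> on_edge K E (z - x).
  move=> Xx Kx nKx; have [nVx _] := gz x Xx Kx.
  have [xV|[E' E'Es onE']] := bdK Kx nKx; first by case/negP: nVx; exact: xV.
  have [_ _ _ _ par] := gE E EEs; have ee' := par onE0 x E' Xx E'Es onE'.
  have [e'0 _ _] := edgeEs E'Es.
  by split => //; exact: cross_par0 e0 e'0 ee' onE'.2.
have bal : mass X (seg (z - E.2.1) E.1 0 1) = mass X (seg (z - E.2.2) E.1 0 1).
  have pE : z - E.2.1 + (E.2.1 - E.2.2) = z - E.2.2 by vec.
  by rewrite (balEs EEs) pE.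
have [ed|ed|ed] := ltrgtP (cross E.1 d) 0.
- by have [-> ->] := edge_in_count gz Ed EEs ed onE; exact: bal.
- have Ed' E' : E' \in Es -> cross E'.1 (- d) != 0 by move=> /Ed; rewrite crossNr oppr_eq0.
  have ed' : cross E.1 (- d) < 0 by rewrite crossNr oppr_lt0.
  have := edge_in_count gz Ed' EEs ed' onE; rewrite opprK => -[-> ->].
  exact/esym.
by case/eqP: (Ed E EEs); exact: ed.
Qed.

Definition line_meet (l l' : plane R * plane R) : plane R :=
  l.1 + (cross (l'.1 - l.1) l'.2 / cross l.2 l'.2) *: l.2.

Lemma line_meetE a e t a' e' t' z : cross e e' != 0 -> z = a + t *: e -> z = a' + t' *: e' ->
  z = line_meet (a, e) (a', e').
Proof.
move=> ee' z1 z2; rewrite {1}z1 /line_meet /=; congr (_ + _ *: _).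
have h : a' - a = t *: e - t' *: e'.
  have h : a + t *: e = a' + t' *: e' by rewrite -z1.
  have -> : a = a' + t' *: e' - t *: e by rewrite -h; vec.
  by vec.
by rewrite h !crossE; field.
Qed.

(** Finitely many translates reach [C]; their exceptional points, their edge ends and the
    intersections of their edge lines form the list. For parallel lines [line_meet] divides by 0 and
    only adds a harmless point. *)
Lemma finitely_many_nongeneric (C : set (plane R)) : bounded_set C ->
  exists s : seq (plane R), forall z, C z -> z \notin s -> generic z.
Proof.
move=> bC.
have bD : bounded_set [set x | exists2 z, C z & K (z - x)].
  apply: bounded_subset (bounded_diff bC (compact_bounded coK)) => x [z Cz Kx].
  by exists z, (z - x); split => //; rewrite subKr.
have /finite_seqP[xs xsE] := dX bD.
have memxs z x : C z -> K (z - x) -> X x != 0%N -> x \in xs.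
  by move=> Cz Kx Xx; have : [set` xs] x by rewrite -xsE; split => //; exists z.
pose pts E := [:: E.2.1; E.2.1 + E.1; E.2.2; E.2.2 + E.1].
pose ls := [seq (xE.1 + xE.2.2.1, xE.2.1) | xE <- [seq (x, E) | x <- xs, E <- Es]] ++
           [seq (xE.1 + xE.2.2.2, xE.2.1) | xE <- [seq (x, E) | x <- xs, E <- Es]].
exists ([seq xv.1 + xv.2 | xv <- [seq (x, v) | x <- xs, v <- V]] ++
  [seq xv.1 + xv.2 | xv <- [seq (x, v) | x <- xs, v <- flatten (map pts Es)]] ++
  [seq line_meet ll.1 ll.2 | ll <- [seq (l, l') | l <- ls, l' <- ls]]) => z Cz.
rewrite !mem_cat !negb_or => /and3P[n1 n2 n3] x Xx Kx.
have xxs := memxs z x Cz Kx Xx.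
have zE : z = x + (z - x) by vec.
split.
  apply: contra n1 => zV; apply/mapP; exists (x, z - x) => //.
  by apply/allpairsP; exists (x, z - x).
move=> E EEs.
have npt v : v \in pts E -> z - x != v.
  move=> vE; apply: contraNneq n2 => zv; apply/mapP; exists (x, v); last by rewrite /= -zv.
  apply/allpairsP; exists (x, v); split => //=.
  by apply/flattenP; exists (pts E) => //; exact: map_f.
split; try by apply: npt; rewrite !inE eqxx ?orbT.
have online x' E' : X x' != 0%N -> E' \in Es -> on_edge K E' (z - x') ->
    exists a t, (a, E'.1) \in ls /\ z = a + t *: E'.1.
  move=> Xx' E'Es [Kx' sE']; have x'xs := memxs z x' Cz Kx' Xx'.
  have [_ top bot] := edgeEs E'Es.
  have pr : (x', E') \in [seq (x, E) | x <- xs, E <- Es].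
    by apply/allpairsP; exists (x', E').
  have zE' : z = x' + (z - x') by vec.
  case: sE' => sE'.
    have [t [_ _ h]] := (top _).1 (conj Kx' sE').
    exists (x' + E'.2.1), t; split; last by rewrite {1}zE' h addrA.
    by rewrite mem_cat; apply/orP; left; apply/mapP; exists (x', E').
  have [t [_ _ h]] := (bot _).1 (conj Kx' sE').
  exists (x' + E'.2.2), t; split; last by rewrite {1}zE' h addrA.
  by rewrite mem_cat; apply/orP; right; apply/mapP; exists (x', E').
move=> onE x' E' Xx' E'Es onE'.
apply/eqP; apply: contraNT n3 => ee'.
have [a [t [al h]]] := online x E Xx EEs onE.
have [a' [t' [al' h']]] := online x' E' Xx' E'Es onE'.
apply/mapP; exists ((a, E.1), (a', E'.1)); last exact: line_meetE ee' h h'.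
by apply/allpairsP; exists ((a, E.1), (a', E'.1)).
Qed.

(** Since the interior is contained in [K], equal counts mean that no translate has [z] on its
    boundary. *)
Definition off_boundary z := closed_count K X z = open_count K X z.

Let clK := compact_plane_closed coK.

Lemma off_boundaryP z : off_boundary z ->
  forall x, X x != 0%N -> K (z - x) -> K^° (z - x).
Proof.
move=> oz x Xx Kx; apply: contrapT => nix.
pose S := [set y | K^° (z - y)].
have bS : bounded_set S.
  by apply: bounded_subset (bounded_reach0 coK z) => y /interior_subset.
have : (mass X ([set x] `|` S) <= closed_count K X z)%N.
  by apply: (mass_le dX (bounded_reach0 coK z)) => y [->|/interior_subset].
rewrite (massU dX (bounded_set1 x) bS); last by rewrite -subset0 => y [->].
rewrite oz mass_set1 /open_count -[leqRHS]add0n leq_add2r leqn0.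
by rewrite (negbTE Xx).
Qed.

Lemma off_boundary_in_count z d : off_boundary z -> in_count K X z d = 0%N.
Proof.
move=> oz; apply: mass_set0 => x Xx [Kx nKx _]; apply: nKx.
exact: off_boundaryP.
Qed.

Lemma off_boundary_crossing z d : off_boundary z -> crossing K X z d.
Proof.
by move=> oz x Xx /(off_boundaryP oz Xx) ix; exists 0; rewrite scale0r addr0.
Qed.

(** [v t] is the count just after [p + t *: d]. By balance it is also the count just before, so [v]
    is locally constant; at both ends nothing is entered and [v] is the count itself. *)
Lemma constant_on_path p d : off_boundary p -> off_boundary (p + d) ->
  (forall t, 0 <= t -> t <= 1 -> crossing K X (p + t *: d) d /\
     in_count K X (p + t *: d) d = in_count K X (p + t *: d) (- d)) ->
  closed_count K X p = closed_count K X (p + d).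
Proof.
move=> op oq path.
pose v t := (open_count K X (p + t *: d) + in_count K X (p + t *: d) d)%N.
have v0 : v 0 = closed_count K X p.
  have p0 : p + 0 *: d = p by rewrite scale0r addr0.
  by rewrite /v p0 (off_boundary_in_count d op) addn0; exact: esym op.
have v1 : v 1 = closed_count K X (p + d).
  by rewrite /v scale1r (off_boundary_in_count d oq) addn0; exact: esym oq.
rewrite -v0 -v1; apply: locally_constant01 => t t0 t1.
have [cr bal] := path t t0 t1.
have [e1 e10 h1] := (near0P _).1 (near0_ray_count coK cK dX cr).
have [e2 e20 h2] := (near0P _).1 (near0_ray_count coK cK dX (crossingN cr)).
have right s : 0 <= s -> s <= 1 ->
    \forall r \near 0^'+, v s = closed_count K X (p + (s + r) *: d).
  move=> s0 s1; have [crs _] := path s s0 s1.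
  have := near0_ray_count coK cK dX crs; apply: filterS => r [h _].
  have sE : p + (s + r) *: d = p + s *: d + r *: d by vec.
  by rewrite /v -h sE.
exists (Num.min e1 e2); first by rewrite lt_min e10.
move=> s s0 s1; rewrite lt_min => /andP[se1 se2].
have [st|ts|->//] := ltrgtP s t.
  have d0 : 0 < t - s by rewrite subr_gt0.
  have [r r0 [-> [_ rd]]] := near0_ex (filterI (right s s0 s1) (near0_lt d0)).
  have w0 : 0 < t - (s + r) by lra.
  have we : t - (s + r) < e2.
    by apply: le_lt_trans se2; rewrite distrC ger0_norm; lra.
  have [h _] := h2 (t - (s + r)) w0 we.
  have sE : p + (s + r) *: d = p + t *: d + (t - (s + r)) *: - d by vec.
  by rewrite /v bal -h sE.
have d0 : 0 < e1 - (s - t).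
  by rewrite subr_gt0; apply: le_lt_trans se1; exact: ler_norm.
have [r r0 [-> [_ rd]]] := near0_ex (filterI (right s s0 s1) (near0_lt d0)).
have w0 : 0 < s + r - t by lra.
have we : s + r - t < e1 by lra.
have [h _] := h1 (s + r - t) w0 we.
have sE : p + (s + r) *: d = p + t *: d + (s + r - t) *: d by vec.
by rewrite /v -h sE.
Qed.

Lemma independent_neq0 u v w : cross u v != 0 -> w != 0 ->
  (cross w u != 0) || (cross w v != 0).
Proof.
move=> uv; apply: contraNT; rewrite negb_or !negbK => /andP[/eqP wu /eqP wv].
by rewrite (cross_basis w uv) (crossC u w) wu wv oppr0 !mul0r !scale0r addr0.
Qed.

(** The segment from [p] to [q] may run along edges or through bad points. Moving its end to
    [q + t *: h] with small [t] keeps the count at the end, and a generic [t] makes the segment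
    transversal to all edges and free of nongeneric points other than [p]. *)
Lemma off_boundary_constant p q : off_boundary p -> off_boundary q ->
  closed_count K X p = closed_count K X q.
Proof.
move=> op oq; have [->//|pq] := eqVneq q p.
have qp0 : q - p != 0 by rewrite subr_eq0.
have [h qh] := exists_transversal qp0.
have qh0 : cross (q - p) h != 0 by rewrite gt_eqF.
pose C := [set z : plane R | `|z| <= `|p| + (`|q| + `|h| + `|p|)].
have bC : bounded_set C by apply/bounded_setE; eexists => z; exact.
have [s hs] := finitely_many_nongeneric bC.
have near_q := near0_ray_count coK cK dX (off_boundary_crossing h oq).
have near_e : \forall t \near 0^'+, forall E, E \in Es ->
    cross E.1 (q - p) + t * cross E.1 h != 0.
  apply: near0_seq => E EEs; apply: near0_neq_affine.
  by apply: independent_neq0 => //; case: (edgeEs EEs).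
have near_s : \forall t \near 0^'+, forall b, b \in s ->
    b != p -> cross (b - p) (q - p) + t * cross (b - p) h != 0.
  apply: near0_seq => b _; have [->|bp] := eqVneq b p; first by apply: nearW.
  have bp0 : b - p != 0 by rewrite subr_eq0.
  have := near0_neq_affine (independent_neq0 qh0 bp0).
  exact: filterS.
have [t t0 [[hc ho] [he [hb [_ t1]]]]] :=
  near0_ex (filterI near_q (filterI near_e (filterI near_s (near0_lt ltr01)))).
have [d dE] : exists d, d = (q - p) + t *: h by exists ((q - p) + t *: h).
have qE : q + t *: h = p + d by rewrite dE; vec.
have -> : closed_count K X q = closed_count K X (p + d).
  by rewrite -qE hc (off_boundary_in_count h oq) addn0; exact: oq.
apply: (constant_on_path op); first by rewrite /off_boundary -qE hc ho.
move=> r r0 r1.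
have Ed E : E \in Es -> cross E.1 d != 0.
  by move=> EEs; rewrite dE crossDr crossZr; exact: he.
have [zp|zp] := eqVneq (p + r *: d) p.
  rewrite zp; split; first exact: off_boundary_crossing.
  by rewrite !(off_boundary_in_count _ op).
have gz : generic (p + r *: d).
  apply: hs.
    rewrite /C /= (le_trans (ler_normD _ _)) // lerD2l normrZ ger0_norm //.
    apply: (@le_trans _ _ `|d|); first by rewrite ler_piMl.
    have -> : d = q + t *: h - p by rewrite dE; vec.
    rewrite (le_trans (ler_normB _ _)) // lerD2r (le_trans (ler_normD _ _)) //.
    by rewrite lerD2l normrZ gtr0_norm // ler_piMl // ltW.
  apply/negP => zs; have := hb _ zs zp.
  rewrite -crossZr -crossDr -dE.
  have -> : p + r *: d - p = r *: d by vec.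
  by rewrite crossZl crossvv mulr0 eqxx.
by split; [exact: generic_crossing|exact: generic_balance].
Qed.

Lemma balanced_tiling : (exists x, X x != 0%N) ->
  exists2 k, (0 < k)%N & is_kfold_translative_tiling k K X.
Proof.
move=> [x0 Xx0].
pose e : plane R := const_mx 1.
have e0 : e != 0 := const1_neq0 R.
have [d ed] := exists_transversal e0.
have de : cross d e != 0 by rewrite crossC oppr_eq0 gt_eqF.
(* A small move along [e] makes direction [d] generic, and a small move along [d] then leaves all
   boundaries. By semicontinuity the closed count does not grow and the open count does not drop. *)
have nearby z : exists y, [/\ off_boundary y, (closed_count K X y <= closed_count K X z)%N &
    (open_count K X z <= open_count K X y)%N].
  have [t _ [cr [h1 h2]]] := near0_ex (filterI (near0_crossing coK cK K0 dX z de)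
    (filterI (near0_mass_le coK dX z e) (near0_interior_mass_le coK dX z e))).
  have [s _ [[c1 c2] [h3 h4]]] := near0_ex (filterI (near0_ray_count coK cK dX cr)
    (filterI (near0_mass_le coK dX (z + t *: e) d)
             (near0_interior_mass_le coK dX (z + t *: e) d))).
  exists (z + t *: e + s *: d); split; first by rewrite /off_boundary c1 c2.
    exact: leq_trans h3 h1.
  exact: leq_trans h2 h4.
have [p [op _ _]] := nearby 0.
have tile z : (closed_count K X p <= closed_count K X z)%N /\
              (open_count K X z <= closed_count K X p)%N.
  have [y [oy h1 h2]] := nearby z.
  by rewrite (off_boundary_constant op oy); split => //; rewrite oy.
exists (closed_count K X p); last first.
  by split => // z; rewrite !cover_countE; exact: tile.
have [z Kz] := K0.
apply: leq_trans (tile (x0 + z)).2.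
apply/(mass_gt0 dX).
  by apply: bounded_subset (bounded_reach0 coK (x0 + z)) => x /interior_subset.
exists x0; last exact: Xx0.
have zE : x0 + z - x0 = z by vec.
by rewrite /= zE.
Qed.

End BalancedTiling.

(** * Balanced lattices *)

Section Lattice.
Variables (R : realType) (g1 g2 : plane R) (N : nat).
Hypotheses (g12 : cross g1 g2 != 0) (N0 : (0 < N)%N).
Implicit Types (e c p v x : plane R).

Let L := frac_lattice g1 g2 N.
Let X := multiset_of_set L.

Let NR0 : N%:R != 0 :> R.
Proof. by rewrite pnatr_eq0 -lt0n. Qed.

Lemma frac_latticeD x v : L x -> L v -> L (x + v).
Proof.
move=> [a [b h]] [a' [b' h']]; exists (a + a'), (b + b').
by rewrite scalerDr h h' !intrD; vec.
Qed.

Lemma frac_latticeN x : L x -> L (- x).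
Proof.
by move=> [a [b h]]; exists (- a), (- b); rewrite scalerN h !mulrNz; vec.
Qed.

Lemma frac_latticeZ (n : int) x : L x -> L (n%:~R *: x).
Proof.
move=> [a [b h]]; exists (n * a), (n * b).
by rewrite scalerA mulrC -scalerA h !intrM; vec.
Qed.

Lemma frac_lattice_period v : L v -> forall x, X (x + v) = X x.
Proof.
move=> Lv x; rewrite /X /multiset_of_set; congr nat_of_bool; apply/idP/idP.
  rewrite !inE => h; have -> : x = x + v + - v by vec.
  exact: frac_latticeD h (frac_latticeN Lv).
by rewrite !inE => h; exact: frac_latticeD.
Qed.

Lemma frac_lattice_is_lattice : is_lattice L.
Proof.
exists (N%:R^-1 *: g1), (N%:R^-1 *: g2); split.
  by apply: free_cross; rewrite crossZr crossZl !mulf_neq0 // invr_eq0.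
have intE (a b : int) : (N%:R^-1 *: g1) *~ a + (N%:R^-1 *: g2) *~ b =
    N%:R^-1 *: (a%:~R *: g1 + b%:~R *: g2).
  rewrite -(scaler_int a (N%:R^-1 *: g1)) -(scaler_int b (N%:R^-1 *: g2)); vec.
apply/seteqP; split=> [x [a [b h]]|x [a [b ->]]]; exists a, b; rewrite intE.
  by rewrite -h scalerK.
by rewrite scalerA divff // scale1r.
Qed.

Lemma frac_lattice_discrete : discrete_multiset X.
Proof.
move=> B /bounded_setE[M hM].
pose D := `|cross g1 g2|.
have D0 : 0 < D by rewrite normr_gt0.
(* Cramer's rule bounds the integer coordinates: [a * cross g1 g2 = N * cross x g2], and likewise
   for [b]. *)
pose W := N%:R * (2 * M * (`|g1| + `|g2|)) / D.
pose A := (Num.truncn W).+1.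
have coord (a : int) (r : R) : `|r| <= 2 * M * (`|g1| + `|g2|) ->
    a%:~R * cross g1 g2 = N%:R * r -> a + A%:Z \in [seq i%:Z | i <- iota 0 (A + A).+1].
  move=> rM h; have aW : `|a%:~R| <= W.
    rewrite /W ler_pdivlMr // /D -normrM h normrM [`|N%:R|]ger0_norm //.
    by rewrite ler_wpM2l.
  have aA : `|a| < A%:Z.
    rewrite -(ltr_int R) intr_norm; apply: le_lt_trans aW _.
    by rewrite /A truncnS_gt.
  have aA' : - A%:Z < a < A%:Z by rewrite -ltr_norml.
  apply/mapP; exists (absz (a + A%:Z)); first by rewrite mem_iota; lia.
  lia.
pose I := [seq i%:Z | i <- iota 0 (A + A).+1].
pose S : seq (plane R) := [seq N%:R^-1 *: ((ij.1 - A%:Z)%:~R *: g1 + (ij.2 - A%:Z)%:~R *: g2)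
  | ij <- [seq (i, j) | i <- I, j <- I]].
apply: (@sub_finite_set _ _ [set` S]); last exact: finite_seq.
move=> x [Bx /= Xx].
have [a [b h]] : L x.
  by move: Xx; rewrite /X /multiset_of_set; case: (boolP (x \in L)) => //; rewrite inE.
have xM := hM x Bx; have M0 : 0 <= M by apply: le_trans xM.
have c1 : `|cross x g2| <= 2 * M * (`|g1| + `|g2|).
  apply: le_trans (cross_le_norm _ _) _; have := normr_ge0 g1; have := normr_ge0 g2.
  have := normr_ge0 x; nra.
have c2 : `|cross g1 x| <= 2 * M * (`|g1| + `|g2|).
  apply: le_trans (cross_le_norm _ _) _; have := normr_ge0 g1; have := normr_ge0 g2.
  have := normr_ge0 x; nra.
have ha : a + A%:Z \in I.
  apply: coord c1 _; rewrite -crossZl h !crossE; ring.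
have hb : b + A%:Z \in I.
  apply: coord c2 _; rewrite -crossZr h !crossE; ring.
rewrite /=; apply/mapP; exists (a + A%:Z, b + A%:Z).
  by apply/allpairsP; exists (a + A%:Z, b + A%:Z).
by rewrite /= !addrK -h scalerK.
Qed.

Lemma mass_seg_period p v e (a b : R) : L v ->
  mass X (seg (p + v) e a b) = mass X (seg p e a b).
Proof.
move=> Lv; rewrite -[RHS](mass_shift _ (frac_lattice_period Lv)); congr mass.
apply/seteqP; split=> x [t [t0 t1 h]]; exists t; split => //.
  by rewrite h; vec.
by transitivity (x - v + v); [vec|rewrite h; vec].
Qed.

(** A window is exactly one period: sliding it by a fraction [f] trades the piece [[0, f)] for
    [[1, 1 + f)], its translate by a lattice vector. The integral part of the shift is a lattice
    vector itself. *)
Lemma mass_window_shift p e (s : R) : e != 0 -> L e ->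
  mass X (seg (p + s *: e) e 0 1) = mass X (seg p e 0 1).
Proof.
move=> e0 Le; have dX := frac_lattice_discrete.
have frac_shift q (f : R) : 0 <= f -> f < 1 ->
    mass X (seg q e f (f + 1)) = mass X (seg q e 0 1).
  move=> f0 f1.
  rewrite (@seg_split _ _ _ f 1) ?lerDr ?(ltW f1) // (@seg_split _ _ _ 0 f) ?(ltW f1) //.
  rewrite !massU //; try exact: bounded_seg; try exact: seg_disjoint.
  rewrite addnC; congr (_ + _)%N.
  have := seg_shift q e 1 0 f; rewrite add0r scale1r => <-.
  exact: (mass_seg_period q e 0 f (frac_latticeN Le)).
pose n := Num.floor (- s).
have /andP[f0 f1] := fractional_part (- s).
have -> : seg (p + s *: e) e 0 1 = seg p e (- s) (- s + 1).
  have := seg_shift p e (- s) 0 1; rewrite add0r [1 + _]addrC scaleNr opprK.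
  by [].
have -> : seg p e (- s) (- s + 1) =
    seg (p - n%:~R *: e) e (- s - n%:~R) (- s - n%:~R + 1).
  by rewrite seg_shift subrK [_ + 1 + _]addrAC subrK.
rewrite (frac_shift _ _ f0 f1).
exact: (mass_seg_period p e 0 1 (frac_latticeN (frac_latticeZ n Le))).
Qed.

Lemma lattice_edge_balanced e c : e != 0 -> lattice_edge g1 g2 N e c -> balanced X e c.
Proof.
move=> e0 [Lc|[Le [s Ls]]] p; first by rewrite mass_seg_period.
have -> : p + c = p + s *: e + (c - s *: e) by vec.
by rewrite mass_seg_period // mass_window_shift.
Qed.

Lemma lattice_nonempty : exists x, X x != 0%N.
Proof.
exists 0; rewrite /X /multiset_of_set (_ : 0 \in L) // inE.
by exists 0, 0; rewrite scaler0 !scale0r addr0.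
Qed.

End Lattice.

(** * Transversal edges and the parallelogram case *)

Section EdgeDirections.
Variables (R : realType) (K : set (plane R)).
Implicit Types (a b d e p q r u v w x y z : plane R).
Implicit Types E : plane R * (plane R * plane R).
Hypotheses (coK : compact K) (cK : convex_set K) (K0 : K^° !=set0).
Variables (V : seq (plane R)) (Es : seq (plane R * (plane R * plane R))).
Hypothesis edgeEs : forall E, E \in Es -> edge K E.
Hypothesis bdK : forall w, K w -> ~ K^° w -> w \in V \/ exists2 E, E \in Es & on_edge K E w.

Lemma edge_top E : edge K E -> [/\ K E.2.1, K (E.2.1 + E.1) & supp K E.1 E.2.1].
Proof.
move=> [_ top _].
have [Kq sq] : K E.2.1 /\ supp K E.1 E.2.1.
  by apply/top; exists 0; split; [exact: lexx|exact: ler01|rewrite scale0r addr0].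
have [Kq1 _] : K (E.2.1 + E.1) /\ supp K E.1 (E.2.1 + E.1).
  by apply/top; exists 1; split; [exact: ler01|exact: lexx|rewrite scale1r].
by split.
Qed.

Lemma edge_bot E : edge K E -> [/\ K E.2.2, K (E.2.2 + E.1) & supp K (- E.1) E.2.2].
Proof.
move=> [_ _ bot].
have [Kq sq] : K E.2.2 /\ supp K (- E.1) E.2.2.
  by apply/bot; exists 0; split; [exact: lexx|exact: ler01|rewrite scale0r addr0].
have [Kq1 _] : K (E.2.2 + E.1) /\ supp K (- E.1) (E.2.2 + E.1).
  by apply/bot; exists 1; split; [exact: ler01|exact: lexx|rewrite scale1r].
by split.
Qed.

Lemma edge_width E x y : edge K E -> K x -> K y ->
  `|cross E.1 (x - y)| <= cross E.1 (E.2.1 - E.2.2).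
Proof.
move=> hE Kx Ky; have [_ _ sq] := edge_top hE; have [_ _ sr] := edge_bot hE.
have := sq x Kx; have := sq y Ky; have := sr x Kx; have := sr y Ky.
by rewrite !crossE ler_norml; lra.
Qed.

Lemma edge_width_gt0 E : edge K E -> 0 < cross E.1 (E.2.1 - E.2.2).
Proof.
move=> hE; have [e0 _ _] := hE; have [Kq _ sq] := edge_top hE.
have [z Kz] := K0; have := supp_interior e0 sq Kz.
have := edge_width hE Kq (interior_subset Kz); rewrite ler_norml !crossE => /andP[_].
lra.
Qed.

(** If [c' = t c], comparing the widths of [K] across [e] and [e'] gives [t = 1] or [t = -1]. Then
    [c] already attains the width across [e'], and one of [c + e], [c - e], both differences of
    points of [K], would exceed it. *)
Lemma edge_shift_transversal E E' : edge K E -> edge K E' -> cross E.1 E'.1 != 0 ->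
  cross (E.2.1 - E.2.2) (E'.2.1 - E'.2.2) != 0.
Proof.
move=> hE hE' ee'; apply/negP => /eqP cc'.
have [Kq Kqe _] := edge_top hE; have [Kr Kre _] := edge_bot hE.
have [Kq' _ _] := edge_top hE'; have [Kr' _ _] := edge_bot hE'.
have w0 := edge_width_gt0 hE; have w'0 := edge_width_gt0 hE'.
have b1 := edge_width hE Kq' Kr'.
have b2 := edge_width hE' Kq Kr.
have b3 := edge_width hE' Kqe Kr.
have b4 := edge_width hE' Kq Kre.
have e'e : cross E'.1 E.1 != 0 by rewrite crossC oppr_eq0.
have qe : E.2.1 + E.1 - E.2.2 = (E.2.1 - E.2.2) + E.1 by vec.
have re : E.2.1 - (E.2.2 + E.1) = (E.2.1 - E.2.2) - E.1 by vec.
move: b1 b2 b3 b4 w0 w'0 cc'; rewrite qe re.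
move: (E.2.1 - E.2.2) (E'.2.1 - E'.2.2) => c c' b1 b2 b3 b4 w0 w'0 cc'.
have c0 : c != 0 by apply: contraTneq w0 => ->; rewrite cross0r ltxx.
have [t c'E] := cross_parallel c0 cc'.
move: b1 b2 b3 b4 w'0; rewrite c'E !crossE.
move: (cross E.1 c) (cross E'.1 c) (cross E'.1 E.1) w0 e'e => A B D A0 D0.
rewrite !ler_norml => /andP[b1 b1'] /andP[b2 b2'] /andP[b3 b3'] /andP[b4 b4'] w'0.
have t1 : t <= 1 by nra.
have t2 : -1 <= t by nra.
have [t0|t0] := lerP 0 t.
  have B0 : 0 < B by nra.
  have : t = 1 by nra.
  move=> tE; move: D0; rewrite tE in b3' b4'; suff -> : D = 0 by rewrite eqxx.
  lra.
have B0 : B < 0 by nra.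
have : t = -1 by nra.
move=> tE; move: D0; rewrite tE in b3 b4 b3' b4'; suff -> : D = 0 by rewrite eqxx.
lra.
Qed.

(** A ray in direction [u] from an interior point, chosen so that its line avoids [V], leaves [K] on
    an edge. Were this edge parallel to [u], the interior point would lie on a supporting line. *)
Lemma exists_transversal_edge u : u != 0 -> exists2 E, E \in Es & cross u E.1 != 0.
Proof.
move=> u0; have [z0 Kz0] := K0; have [h uh] := exists_transversal u0.
have gen : \forall t \near 0^'+, forall v, v \in V -> cross u (z0 - v) + t * cross u h != 0.
  by apply: near0_seq => v _; apply: near0_neq_affine; rewrite (gt_eqF uh) orbT.
have near_int := @near0_ray R (plane R) _ z0 h (nbhs_interior Kz0).
have [t _ [nV Kz]] := near0_ex (filterI gen near_int).
move: nV Kz => nV; have [z zE] : exists z, z = z0 + t *: h by exists (z0 + t *: h).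
rewrite -zE => Kz.
have [s s0 [Kw nKw _]] := exit_point coK Kz u0.
have uw : cross u (z + s *: u) = cross u z by rewrite !crossE mulr0 addr0.
have [wV|[E EEs [_ sE]]] := bdK Kw nKw.
  have := nV _ wV; rewrite crossDr crossNr uw zE crossDr crossZr.
  by rewrite opprD addNKr addNr eqxx.
exists E => //; apply/negP => /eqP ue; have [e0 _ _] := edgeEs EEs.
have Nu0 : - u != 0 by rewrite oppr_eq0.
have [su|su] := cross_par0 u0 e0 ue sE.
  by have := supp_interior u0 su Kz; rewrite uw ltxx.
by have := supp_interior Nu0 su Kz; rewrite !crossNl uw ltxx.
Qed.

(** At almost every height over [E1.1] the chord parallel to [E1.1] ends on the two opposite edges
    along [E2.1]. Hence the width of [K] across [E1.1] is that of [E2.1] alone, which fixes the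
    translation up to a sign and a multiple of [E1.1]. *)
Lemma parallelogram_shift E1 E2 : E1 \in Es -> E2 \in Es -> cross E1.1 E2.1 != 0 ->
  (forall w, K w -> ~ K^° w -> w \in V \/ on_edge K E1 w \/ on_edge K E2 w) ->
  exists s t : R, (t = 1 \/ t = -1) /\ E1.2.1 - E1.2.2 = s *: E1.1 + t *: E2.1.
Proof.
move=> E1s E2s e12 bd; have hE1 := edgeEs E1s; have hE2 := edgeEs E2s.
have [e10 top1 bot1] := hE1; have [e20 top2 bot2] := hE2.
have [Kq1 _ sq1] := edge_top hE1; have [Kr1 _ sr1] := edge_bot hE1.
have [Kq2 Kqe2 _] := edge_top hE2.
pose f := cross E1.1.
have Ne10 : - E1.1 != 0 by rewrite oppr_eq0.
have width0 := edge_width_gt0 hE1.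
have mM : f E1.2.2 < f E1.2.1 by move: width0; rewrite !crossE subr_gt0.
have onlevel (b : R) : f E1.2.2 < b -> b < f E1.2.1 ->
    (forall v, v \in V -> b != f v) ->
    exists t, [/\ 0 <= t, t <= 1 & b = f E2.2.1 + t * f E2.1].
  move=> mb bM nV.
  have [h fh] := exists_transversal e10.
  have fhN : cross E1.1 h != 0 by rewrite gt_eqF.
  have [y fy] : exists y, f y = b.
    by exists ((b / f h) *: h); rewrite /f crossZr; field.
  have [s Ks] : exists s, K^° (y + s *: E1.1).
    by apply: (cross_level cK K0 Kr1 Kq1); rewrite -/f fy.
  move: Ks; have [z zE] : exists z, z = y + s *: E1.1 by exists (y + s *: E1.1).
  rewrite -zE => Kz; have fz : f z = b by rewrite zE /f !crossE mulr0 addr0.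
  have [s1 s10 [Kw1 nKw1 _]] := exit_point coK Kz e10.
  have [s2 s20 [Kw2 nKw2 _]] := exit_point coK Kz Ne10.
  have on2 w : f w = b -> K w -> ~ K^° w ->
      supp K E2.1 w \/ supp K (- E2.1) w.
    move=> fw Kw nKw; have [wV|[[_ [sw|sw]]|[_ //]]] := bd w Kw nKw.
    - by have := nV w wV; rewrite fw eqxx.
    - by have := sw _ Kq1; rewrite -/(f _) -/(f w) fw leNgt bM.
    - by have := sw _ Kr1; rewrite !crossNl lerN2 -/(f _) -/(f w) fw leNgt mb.
  have fw1 : f (z + s1 *: E1.1) = b by rewrite /f !crossE mulr0 addr0.
  have fw2 : f (z + s2 *: - E1.1) = b by rewrite /f !crossE oppr0 mulr0 addr0.
  have found w : f w = b -> K w -> supp K E2.1 w ->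
      exists t, [/\ 0 <= t, t <= 1 & b = f E2.2.1 + t * f E2.1].
    move=> fw Kw sw; have [t [t0 t1 h']] := (top2 w).1 (conj Kw sw).
    by exists t; split => //; rewrite -fw h' /f crossDr crossZr.
  have e21 : cross E2.1 E1.1 != 0 by rewrite crossC oppr_eq0.
  (* If both ends were on the supporting line for [- E2.1], their difference, a nonzero multiple of
     [E1.1], would be parallel to [E2.1]. *)
  have [sw1|sw1] := on2 _ fw1 Kw1 nKw1; first exact: found fw1 Kw1 sw1.
  have [sw2|sw2] := on2 _ fw2 Kw2 nKw2; first exact: found fw2 Kw2 sw2.
  have := sw1 _ Kw2; have := sw2 _ Kw1; rewrite !crossE => h1 h2.
  have : (s1 + s2) * cross E2.1 E1.1 = 0 by lra.
  by move/eqP; rewrite mulf_eq0 (negbTE e21) orbF gt_eqF // addr_gt0.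
pose D := f E2.1.
have wD : f E1.2.1 - f E1.2.2 = `|D|.
  apply/eqP; rewrite eq_le; apply/andP; split; last first.
    have := edge_width hE1 Kqe2 Kq2.
    rewrite (_ : E2.2.1 + E2.1 - E2.2.1 = E2.1); last by vec.
    by rewrite /D /f !crossE.
  rewrite leNgt; apply/negP => Dlt.
  (* For [t] below half of the excess, the two heights at distance [t] from top and bottom differ by
     more than [|D|], yet both occur on a single edge along [E2.1]. *)
  have g0 : 0 < (f E1.2.1 - f E1.2.2 - `|D|) / 2 by rewrite divr_gt0 // subr_gt0.
  have gen1 : \forall t \near 0^'+, forall v, v \in V -> f E1.2.2 - f v + t * 1 != 0.
    by apply: near0_seq => v _; apply: near0_neq_affine; rewrite oner_eq0 orbT.
  have gen2 : \forall t \near 0^'+, forall v, v \in V -> f E1.2.1 - f v + t * -1 != 0.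
    by apply: near0_seq => v _; apply: near0_neq_affine; rewrite oppr_eq0 oner_eq0 orbT.
  have [t t0 [n1 [n2 [_ tg]]]] := near0_ex (filterI gen1 (filterI gen2 (near0_lt g0))).
  have D0 := normr_ge0 D.
  have [||v vV|a [a0 a1 ha]] := onlevel (f E1.2.2 + t); [by lra|by lra| |].
    by apply: contraNneq (n1 v vV) => <-; apply/eqP; ring.
  have [||v vV|b [b0 b1 hb]] := onlevel (f E1.2.1 - t); [by lra|by lra| |].
    by apply: contraNneq (n2 v vV) => <-; apply/eqP; ring.
  have : (b - a) * D <= `|D|.
    apply: le_trans (ler_norm _) _; rewrite normrM ler_piMl //.
    by rewrite ler_norml; lra.
  by rewrite mulrBl; move: ha hb tg; rewrite -/D; lra.
have [t [t1 tD]] : exists t : R, (t = 1 \/ t = -1) /\ `|D| = t * D.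
  have [D0|D0] := lerP 0 D; first by exists 1; split; [left|rewrite mul1r ger0_norm].
  by exists (-1); split; [right|rewrite mulN1r ltr0_norm].
have [|s hs] := @cross_parallel _ E1.1 (E1.2.1 - E1.2.2 - t *: E2.1) e10.
  by rewrite !crossE -/f wD tD /D /f subrr.
by exists s, t; split => //; rewrite -hs; vec.
Qed.

End EdgeDirections.

(** * Multiple lattice tilings from lattices balanced on all edges *)

Lemma lattice_edges_tile (R : realType) (K : set (plane R)) (V : seq (plane R))
    (Es : seq (plane R * (plane R * plane R))) (g1 g2 : plane R) (N : nat) :
  compact K -> convex_set K -> K^° !=set0 -> cross g1 g2 != 0 -> (0 < N)%N ->
  (forall E, E \in Es -> edge K E) ->
  (forall w, K w -> ~ K^° w -> w \in V \/ exists2 E, E \in Es & on_edge K E w) ->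
  (forall E, E \in Es -> lattice_edge g1 g2 N E.1 (E.2.1 - E.2.2)) ->
  multiple_lattice_tile K.
Proof.
move=> coK cK K0 g12 N0 hE bd lat.
have dX := frac_lattice_discrete g12 N0.
have bal E : E \in Es ->
    balanced (multiset_of_set (frac_lattice g1 g2 N)) E.1 (E.2.1 - E.2.2).
  move=> EEs; apply: (lattice_edge_balanced g12 N0 _ (lat E EEs)).
  by case: (hE E EEs).
have [k k0 tile] := balanced_tiling coK cK K0 dX hE bal bd (lattice_nonempty g1 g2 N).
exists k, (frac_lattice g1 g2 N); split; first exact: k0.
by split; [exact: frac_lattice_is_lattice|exact: tile].
Qed.

Theorem theorem1 (R : realType) (K : set (plane R))
  (hK : convex_body K) (hint : (interior K !=set0)%classic)
  (htile : multiple_translative_tile K) :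
  multiple_lattice_tile K.
Proof.
have [coK cK] := hK; have [k [X [k0 tile]]] := htile.
have [V [Es [hEs bd]]] := tile_edges coK cK hint k0 tile.
have hE E : E \in Es -> edge K E by move=> /hEs[].
have transversal := exists_transversal_edge coK hint hE bd.
have [E1 E1s _] := transversal _ (const1_neq0 R).
have [e10 _ _] := hE _ E1s.
have [E2 E2s e12] := transversal _ e10.
have [[E3 E3s [e13 e23]]|no3] := pselect (exists2 E, E \in Es &
    cross E1.1 E.1 != 0 /\ cross E2.1 E.1 != 0).
  pose P (E : plane R * (plane R * plane R)) := (E.1, E.2.1 - E.2.2).
  have shiftN0 E E' : E \in Es -> E' \in Es -> cross E.1 E'.1 != 0 ->
      cross (P E).2 (P E').2 != 0.
    by move=> Es_ E's; apply: (edge_shift_transversal hint (hE _ Es_) (hE _ E's)).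
  have hP p : p \in map P Es -> p.1 != 0 /\ balanced X p.1 p.2.
    by move=> /mapP[E EEs ->]; have [[e0 _ _] bal] := hEs E EEs.
  have [g1 [g2 [g12 [N N0 lat]]]] := common_lattice tile.1
    (tiling_nonempty coK k0 tile) hP
    (map_f P E1s) (map_f P E2s) (map_f P E3s) e12 e13 e23
    (shiftN0 _ _ E1s E2s e12) (shiftN0 _ _ E1s E3s e13) (shiftN0 _ _ E2s E3s e23).
  apply: (lattice_edges_tile coK cK hint g12 N0 hE bd) => E EEs.
  exact: (lat _ (map_f P EEs)).
have bd2 w : K w -> ~ K^° w -> w \in V \/ on_edge K E1 w \/ on_edge K E2 w.
  move=> Kw nKw; have [wV|[E EEs [_ sE]]] := bd w Kw nKw; first by left.
  right; have [e0 _ _] := hE _ EEs.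
  have [e1E|e1E] := eqVneq (cross E1.1 E.1) 0.
    by left; split; [exact: Kw|exact: cross_par0 e10 e0 e1E sE].
  have [e20 _ _] := hE _ E2s.
  have [e2E|e2E] := eqVneq (cross E2.1 E.1) 0.
    by right; split; [exact: Kw|exact: cross_par0 e20 e0 e2E sE].
  by case: no3; exists E.
have e21 : cross E2.1 E1.1 != 0 by rewrite crossC oppr_eq0.
have bd2' w : K w -> ~ K^° w -> w \in V \/ on_edge K E2 w \/ on_edge K E1 w.
  by move=> Kw nKw; have [|[|]] := bd2 w Kw nKw; [left|right; right|right; left].
have [s1 [t1 [ht1 c1]]] := parallelogram_shift coK cK hint hE E1s E2s e12 bd2.
have [s2 [t2 [ht2 c2]]] := parallelogram_shift coK cK hint hE E2s E1s e21 bd2'.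
have lat1 : frac_lattice E1.1 E2.1 1 E1.1 by exists 1, 0; vec.
have lat2 : frac_lattice E1.1 E2.1 1 E2.1 by exists 0, 1; vec.
have sign t e : t = 1 \/ t = -1 -> frac_lattice E1.1 E2.1 1 e ->
    frac_lattice E1.1 E2.1 1 (t *: e).
  case=> -> Le; first by rewrite scale1r.
  by rewrite scaleN1r; exact: frac_latticeN.
(* Every other member of [Es] is parallel to [E1] or [E2] and lies on the same supporting lines, so
   two edges suffice. In both cases the edge vector is a period and the translation is, modulo that
   vector, plus or minus the other one; so [N = 1]. *)
apply: (@lattice_edges_tile R K V [:: E1; E2] E1.1 E2.1 1 coK cK hint e12 isT).
- by move=> E; rewrite !inE => /orP[]/eqP ->; exact: hE.
- move=> w Kw nKw; have [?|[on1|on2]] := bd2 w Kw nKw; first by left.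
    by right; exists E1; rewrite ?inE ?eqxx.
  by right; exists E2; rewrite ?inE ?eqxx ?orbT.
move=> E; rewrite !inE => /orP[]/eqP ->; right; split; [exact: lat1| |exact: lat2|].
  exists s1; rewrite c1; have -> : s1 *: E1.1 + t1 *: E2.1 - s1 *: E1.1 = t1 *: E2.1 by vec.
  exact: sign ht1 lat2.
exists s2; rewrite c2; have -> : s2 *: E2.1 + t2 *: E1.1 - s2 *: E2.1 = t2 *: E1.1 by vec.
exact: sign ht2 lat1.
Qed.
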